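(* In the stochastic opinion dynamics described below, let $x\in\{\mathbf 0,\mathbf 1\}$. If $\lambda_{\max}(J(x))>1$, then $\mathbb{P}[\beta(t)\to x]=0$. Conversely, if $\lambda_{\max}(J(x))\le 1$, then $\mathbb{P}[\beta(t)\to x]=1$.
   Context: Let $A=(a_{i,j})$ be a symmetric $n\times n$ matrix with nonnegative entries, the weighted adjacency matrix of an undirected graph $G$ on $\{1,\dots,n\}$ (self-loops allowed) that is connected and not bipartite; let $\deg(i)=\sum_j a_{i,j}$, $D=\mathrm{diag}(\deg(1),\dots,\deg(n))$, $W=D^{-1}A$. Each agent $i$ has a bias parameter $\gamma_i>0$, $\Gamma=\mathrm{diag}(\gamma_1,\dots,\gamma_n)\neq I$. $\mathbf 0,\mathbf 1$ are the all-zeros and all-ones vectors; $J(\mathbf{0})=\Gamma W$ and $J(\mathbf{1})=\Gamma^{-1}W$ (these have real eigenvalues), and $\lambda_{\max}$ denotes the largest eigenvalue. Define $f(\mu,\gamma)=\frac{\gamma\mu}{1+(\gamma-1)\mu}$ for $\mu\in[0,1]$, and for $\beta\in[0,1]^n$ let $\mu_i(\beta)=\frac{1}{\deg(i)}\sum_j a_{i,j}\beta_j$. Dynamics: $\beta_i(1)\in(0,1)$ are given initial values. For each $t\ge1$, conditionally on the history $\mathcal{H}_t$ (all declarations up to time $t$), the declarations $\psi_{i,t+1}\in\{0,1\}$ are independent across $i$ with $\mathbb{P}[\psi_{i,t+1}=1\mid\mathcal{H}_t]=f(\mu_i(\beta(t)),\gamma_i)$, and $\beta_i(t+1)=\frac{t}{t+1}\beta_i(t)+\frac{1}{t+1}\psi_{i,t+1}$.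 *)

(* Defs.v *)
From HB Require Import structures.
From mathcomp Require Import all_boot all_order all_algebra.
From mathcomp Require Import all_classical all_reals all_analysis.
Set Implicit Arguments. Unset Strict Implicit. Unset Printing Implicit Defensive.
Import Order.TTheory GRing.Theory Num.Theory.
Import numFieldNormedType.Exports.
Local Open Scope classical_set_scope.
Local Open Scope ring_scope.

Section Defs.
Variables (R : realType) (n : nat).

Definition edge (A : 'M[R]_n) : rel 'I_n := fun i j => 0 < A i j.

Definition graph_connected (A : 'M[R]_n) : Prop :=
  forall i j : 'I_n, connect (edge A) i j.

Definition graph_bipartite (A : 'M[R]_n) : Prop :=
  exists c : 'I_n -> bool, forall i j, edge A i j -> c i != c j.

Definition deg (A : 'M[R]_n) (i : 'I_n) : R := \sum_(j < n) A i j.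

Definition Wmx (A : 'M[R]_n) : 'M[R]_n := \matrix_(i, j) (A i j / deg A i).

Definition J0 (A : 'M[R]_n) (gamma : 'I_n -> R) : 'M[R]_n :=
  \matrix_(i, j) (gamma i * Wmx A i j).
Definition J1 (A : 'M[R]_n) (gamma : 'I_n -> R) : 'M[R]_n :=
  \matrix_(i, j) ((gamma i)^-1 * Wmx A i j).

Definition Jx (b : bool) (A : 'M[R]_n) (gamma : 'I_n -> R) : 'M[R]_n :=
  if b then J1 A gamma else J0 A gamma.

Definition xvec (b : bool) : 'I_n -> R := fun _ => (b%:R : R).

(* largest eigenvalue (the eigenvalues of J(x) are real) *)
Definition lambda_max (M : 'M[R]_n) : R := sup [set a : R | eigenvalue M a].

Definition f (mu gam : R) : R := gam * mu / (1 + (gam - 1) * mu).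

Definition mu (A : 'M[R]_n) (beta : 'I_n -> R) (i : 'I_n) : R :=
  (deg A i)^-1 * \sum_(j < n) A i j * beta j.

(* betaS b1 psi k = beta(k+1): beta(1) = b1 and
   beta(t+1) = t/(t+1) beta(t) + 1/(t+1) psi_{t+1}. *)
Fixpoint betaS (b1 : 'I_n -> R) (psi : nat -> 'I_n -> bool) (k : nat)
  : 'I_n -> R :=
  match k with
  | 0 => b1
  | k'.+1 => fun i => (k'.+1%:R / k'.+2%:R) * betaS b1 psi k' i
                      + (k'.+2%:R)^-1 * (psi k'.+2 i)%:R
  end.

Definition bern (p : R) (s : bool) : R := if s then p else 1 - p.

End Defs.

Definition hist_event (T : Type) (n : nat) (psi : nat -> 'I_n -> T -> bool)
  (m : nat) (h : nat -> 'I_n -> bool) : set T :=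
  [set w | forall k, (k < m)%N -> forall i, psi k.+2 i w = h k.+2 i].

(* Main.v *)
Require Import Defs.
From HB Require Import structures.
From mathcomp Require Import all_boot all_order all_algebra.
From mathcomp Require Import all_classical all_reals all_analysis.
From mathcomp Require Import ring lra.
Import Order.TTheory GRing.Theory Num.Theory.
Import numFieldNormedType.Exports.
Local Open Scope classical_set_scope.
Local Open Scope ring_scope.

(* Write F_i(beta) = f(mu_i(beta), gamma_i).  Flipping every declaration
   exchanges the two corners and replaces gamma by 1/gamma, so x = 0 suffices.
   As diag(deg / gamma) J(0) = A is symmetric, lambda = lambda_max(J(0)) has a
   positive eigenvector w.

   If lambda > 1, the potential Phi = sum_i w_i^3 (deg_i / gamma_i) / beta_i has
   conditional drift at most (C - c Phi) / t once every agent has declared 1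
   often enough, which happens almost surely because beta_i >= const / t.  Hence
   E[Phi] stays bounded along a subsequence of times, and min_i beta_i is
   small at such times only with small probability.  Near 0 the boxes
   {beta >= eps w} are mapped strictly inside themselves by F, so, once the
   averaged noise is negligible, beta stays in a slightly larger box after
   having entered one.  Thus almost surely liminf beta_i > 0 for every i.

   If lambda <= 1, comparing quadratic forms at sqrt(gamma) and 1/sqrt(gamma)
   gives lambda_max(J(1)) > 1, so almost surely b = limsup beta is < 1
   componentwise.  By the strong law for the noise and monotonicity of F,
   b <= F(b).  The odds o = b / (1 - b) then satisfy o <= J(0) o by convexity of
   x / (1 - x); pairing with the left Perron vector forces equality in Jensen's
   inequality, hence b is constant on neighbourhoods, hence constant (the graph
   is not bipartite), hence 0 since Gamma <> I. *)

(** * Weighted graphs and Perron eigenvectors *)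

Lemma continuous_sumr {R : realType} (T : topologicalType) (I : finType)
    (F : I -> T -> R) :
  (forall i, continuous (F i)) -> continuous (fun x => \sum_i F i x).
Proof.
move=> cF; apply: (@continuous_big R I +%R 0 xpredT (@add_continuous R)) => i _.
exact: cF.
Qed.

Lemma continuous_coordM {R : realType} {n} (c : R) (i j : 'I_n) :
  continuous (fun x : 'rV[R]_n => c * (x ord0 i * x ord0 j)).
Proof.
move=> x.
have ci k : {for x, continuous (fun x : 'rV[R]_n => x ord0 k)}.
  exact: coord_continuous.
apply: (@continuousM R 'rV[R]_n (cst c)); first exact: cst_continuous.
exact: continuousM.
Qed.

Section Graph.
Context {R : realType} {n : nat} {A : 'M[R]_n}.
Hypothesis Asym : A^T = A.
Hypothesis A_ge0 : forall i j, 0 <= A i j.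
Hypothesis Aconn : graph_connected A.
Hypothesis Anbip : ~ graph_bipartite A.

Lemma adj_sym i j : A i j = A j i.
Proof. by rewrite -{1}Asym mxE. Qed.

Lemma connected_ind (Q : 'I_n -> Prop) (i0 : 'I_n) :
  Q i0 -> (forall i j, edge A i j -> Q i -> Q j) -> forall i, Q i.
Proof.
move=> Q0 Qstep i; have /connectP[p pp ->] := Aconn i0 i.
elim: p i0 Q0 pp => //= j p IH i0 Q0 /andP[e0j pp].
by apply: IH => //; apply: Qstep Q0.
Qed.

(** Crossing an edge swaps the values of [b] and [m], so every vertex carries the pair of [i0] or
    its swap. If the two values differed, the test [b i == b i0] would be a 2-colouring. *)
Lemma edge_const (b m : 'I_n -> R) :
  (forall i j, edge A i j -> b j = m i) -> forall i j, b i = b j /\ m i = b j.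
Proof.
move=> bm i i0.
have alt : forall i, (b i = b i0 /\ m i = m i0) \/ (b i = m i0 /\ m i = b i0).
  apply: (@connected_ind _ i0) => [|k l ekl]; first by left.
  have elk : edge A l k by rewrite /edge adj_sym.
  by have := bm _ _ ekl; have := bm _ _ elk => -> -> [[-> ->]|[-> ->]]; [right|left].
have [e|ne] := eqVneq (b i0) (m i0).
  by case: (alt i) => -[-> ->]; rewrite -?e.
case: Anbip; exists (fun i => b i == b i0) => k l ekl.
have ne' : (m i0 == b i0) = false by rewrite eq_sym (negbTE ne).
by rewrite (bm _ _ ekl); case: (alt k) => -[-> ->]; rewrite !eqxx ne'.
Qed.

(** A vertex without edges would be the whole connected graph, which would then be edgeless and so
    bipartite. *)
Lemma deg_gt0 i : 0 < deg A i.
Proof.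
have [[j eij]|noedge] := pselect (exists j, edge A i j).
  rewrite /deg (bigD1 j) //=; apply: ltr_pwDl => //.
  by apply: sumr_ge0 => k _; apply: A_ge0.
case: Anbip; exists (fun=> true) => k l ekl; exfalso; apply: (noedge); exists l.
suff -> : i = k by [].
apply: (@connected_ind (fun k => i = k) i) => // a c eac ia.
by exfalso; apply: (noedge); exists c; rewrite ia.
Qed.

Lemma sphere_compact (d : 'I_n -> R) : (forall i, 0 < d i) ->
  compact [set x : 'rV[R]_n | \sum_i d i * x ord0 i ^+ 2 = 1].
Proof.
(* The half-width [1 + 1 / d i] bounds the coordinate without a square root, since
   [x i ^+ 2 <= 1 / d i]. *)
move=> d0; apply: (@subclosed_compact _ _
    [set x : 'rV[R]_n | forall i, `[- (1 + (d i)^-1), 1 + (d i)^-1]%classic (x ord0 i)]).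
- have cf : continuous (fun x : 'rV[R]_n => \sum_i d i * x ord0 i ^+ 2).
    by apply: continuous_sumr => i; exact: continuous_coordM.
  have c1 : closed [set x : R | x = 1] by exact: (@closed_eq R 1).
  exact: (preimage_closed (fun x _ => cf x) c1).
- by apply: (@rV_compact R n (fun i => `[- (1 + (d i)^-1), 1 + (d i)^-1]%classic)) => i; exact: segment_compact.
- move=> x /= x1 i; have di := d0 i.
  have : d i * x ord0 i ^+ 2 <= 1.
    rewrite -x1 (bigD1 i) //= lerDl; apply: sumr_ge0 => j _.
    by rewrite mulr_ge0 ?sqr_ge0 // ltW.
  rewrite -ler_pdivlMl // mulr1 => xd; have dV : 0 < (d i)^-1 by rewrite invr_gt0.
  by rewrite in_itv /=; apply/andP; split; nra.
Qed.

Definition quad (x : 'I_n -> R) := \sum_i \sum_j A i j * (x i * x j).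

Lemma quad_continuous : continuous (fun x : 'rV[R]_n => quad (x ord0)).
Proof.
by do 2![apply: continuous_sumr => ?]; exact: continuous_coordM.
Qed.

Lemma quad_abs (x : 'I_n -> R) : quad x <= quad (fun i => `|x i|).
Proof.
do 2![apply: ler_sum => ? _]; apply: ler_wpM2l => //.
by rewrite -normrM ler_norm.
Qed.

Lemma quadD (x y : 'I_n -> R) t :
  quad (fun i => x i + t * y i) =
  quad x + 2 * t * (\sum_i y i * \sum_j A i j * x j) + t ^+ 2 * quad y.
Proof.
have -> : \sum_i y i * \sum_j A i j * x j = \sum_i \sum_j A i j * (y i * x j).
  by apply: eq_bigr => i _; rewrite mulr_sumr; apply: eq_bigr => j _; ring.
have e : \sum_i \sum_j A i j * (y i * x j) = \sum_i \sum_j A i j * (x i * y j).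
  rewrite exchange_big; apply: eq_bigr => i _; apply: eq_bigr => j _.
  by rewrite adj_sym; ring.
have -> (B : R) : 2 * t * B = t * B + t * B by ring.
rewrite {2}e /quad !mulr_sumr -!big_split; apply: eq_bigr => i _ /=.
by rewrite !mulr_sumr -!big_split; apply: eq_bigr => j _ /=; ring.
Qed.

(** Variational proof: maximize [quad] on the ellipsoid [nrm = 1], nonempty thanks to [i0]. Absolute
    values do not decrease [quad], so the maximizer can be taken nonnegative. Stationarity gives the
    eigenvector equation, through which a zero coordinate would spread along edges to all
    vertices. *)
Lemma perron (i0 : 'I_n) (d : 'I_n -> R) : (forall i, 0 < d i) ->
  exists rho w, (forall i, 0 < w i) /\
    forall i, \sum_j A i j * w j = rho * (d i * w i).
Proof.
move=> d0.
pose nrm (x : 'I_n -> R) := \sum_i d i * x i ^+ 2.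
have nrm_ge0 x : 0 <= nrm x by apply: sumr_ge0 => i _; rewrite mulr_ge0 ?sqr_ge0 ?ltW.
have nrm_eq0 x : nrm x = 0 -> forall i, x i = 0.
  move=> /eqP; rewrite psumr_eq0 => [/allP x0 i|i _]; last by rewrite mulr_ge0 ?sqr_ge0 ?ltW.
  by have := x0 i (mem_index_enum _); rewrite mulf_eq0 sqrf_eq0 gt_eqF //= => /eqP.
have nrmZ a x : nrm (fun i => a * x i) = a ^+ 2 * nrm x.
  by rewrite mulr_sumr; apply: eq_bigr => i _; ring.
have quadZ a x : quad (fun i => a * x i) = a ^+ 2 * quad x.
  by rewrite mulr_sumr; apply: eq_bigr => i _; rewrite mulr_sumr; apply: eq_bigr => j _; ring.
have nrmlize x : 0 < nrm x -> nrm (fun i => (Num.sqrt (nrm x))^-1 * x i) = 1.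
  by move=> x0; rewrite nrmZ exprVn sqr_sqrtr // mulVf ?gt_eqF.
have rowE (x : 'I_n -> R) : (\row_i x i) ord0 = x by apply/funext => i; rewrite mxE.
have [|c c1 cmax] := compact_EVT_max _ (sphere_compact d d0) (continuous_subspaceT quad_continuous).
  pose x i : R := (i == i0)%:R.
  have x0 : 0 < nrm x.
    by rewrite /nrm (bigD1 i0) //= ltr_pwDl ?sumr_ge0 // => [|i _]; rewrite /x ?eqxx ?expr1n ?mulr1 // mulr_ge0 ?sqr_ge0 ?ltW.
  by exists (\row_i ((Num.sqrt (nrm x))^-1 * x i)); rewrite /= rowE -[RHS](nrmlize _ x0).
rewrite inE /= in c1.
set rho := quad (c ord0) in cmax.
have rho_max y : quad y <= rho * nrm y.
  have := nrm_ge0 y; rewrite le_eqVlt => /orP[/eqP/esym y0|y0].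
    rewrite y0 mulr0 /quad big1 // => i _; rewrite big1 // => j _.
    by rewrite (nrm_eq0 _ y0) mul0r mulr0.
  have := cmax (\row_i ((Num.sqrt (nrm y))^-1 * y i)).
  rewrite inE /= rowE => /(_ (nrmlize _ y0)).
  by rewrite quadZ exprVn sqr_sqrtr // ler_pdivrMl // mulrC.
pose x i := `|c ord0 i|.
have x1 : nrm x = 1.
  by rewrite -[RHS]c1; apply: eq_bigr => i _; rewrite real_normK // num_real.
have xmax : quad x = rho.
  by apply/eqP; rewrite eq_le -{1}[rho]mulr1 -x1 rho_max /=; exact: quad_abs.
have eig i : \sum_j A i j * x j = rho * (d i * x i).
  pose y k : R := (k == i)%:R.
  have single (g : 'I_n -> R) : \sum_k y k * g k = g i.
    rewrite (bigD1 i) //= /y eqxx mul1r big1 ?addr0 // => k /negbTE ->.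
    by rewrite mul0r.
  set q := \sum_j _.
  have stat t : 2 * t * (q - rho * (d i * x i)) + t ^+ 2 * (quad y - rho * d i) <= 0.
    have := rho_max (fun k => x k + t * y k); rewrite quadD xmax single -/q.
    have -> : nrm (fun k => x k + t * y k) =
        nrm x + 2 * t * (d i * x i) + t ^+ 2 * d i.
      rewrite -(single (fun k => d k * x k)) -(single d) !mulr_sumr -!big_split.
      apply: eq_bigr => k _ /=; rewrite /y; case: (k == i); rewrite ?mulr1n ?mulr0n; ring.
    by rewrite x1; lra.
  have [//|/eqP ne] := eqVneq q (rho * (d i * x i)).
  set a := q - _ in stat; set b := quad y - _ in stat.
  have a0 : a != 0 by rewrite subr_eq0; exact/eqP.
  have a2 : 0 < a ^+ 2 by rewrite exprn_even_gt0.
  (* This [t] turns the polynomial into [t^2 (2 (1 + |b|) + b) > 0], so a nonzero derivative [a]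
     contradicts maximality. *)
  have := stat (a / (1 + `|b|)); have b1 : 0 < 1 + `|b| by rewrite ltr_pwDl.
  rewrite (_ : _ + _ = (a / (1 + `|b|)) ^+ 2 * (2 * (1 + `|b|) + b)); last first.
    by field; rewrite gt_eqF.
  rewrite leNgt => /negP[]; rewrite mulr_gt0 //.
    by rewrite expr_div_n divr_gt0 // exprn_gt0.
  by have := ler_norm (- b); rewrite normrN; lra.
exists rho, x; split=> // i; rewrite lt_def normr_ge0 andbT; apply/eqP => xi0.
have x0 : forall j, x j = 0.
  apply: (@connected_ind _ i xi0) => j k ejk xj0.
  have /eqP := eig j; rewrite xj0 !mulr0 psumr_eq0 => [/allP|l _]; last by rewrite mulr_ge0 ?normr_ge0.
  by move=> /(_ k (mem_index_enum _)); rewrite mulf_eq0 gt_eqF //= => /eqP.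
have := x1; rewrite /nrm big1 => [/eqP|j _]; last by rewrite x0 expr0n mulr0.
by rewrite eq_sym oner_eq0.
Qed.

(** By AM-GM, [2 x_i x_j <= x_i^2 w_j / w_i + x_j^2 w_i / w_j]. Weighted by [A], each half of the
    right side sums to the bound by the eigenvector equation. *)
Lemma quad_le (rho : R) (d w : 'I_n -> R) : (forall i, 0 < w i) ->
  (forall i, \sum_j A i j * w j = rho * (d i * w i)) ->
  forall x, quad x <= rho * \sum_i d i * x i ^+ 2.
Proof.
move=> w0 eig x.
pose G i j := A i j * (x i ^+ 2 * w j / w i).
have GE : \sum_i \sum_j G i j = rho * \sum_i d i * x i ^+ 2.
  rewrite mulr_sumr; apply: eq_bigr => i _.
  transitivity (x i ^+ 2 / w i * \sum_j A i j * w j).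
    by rewrite mulr_sumr; apply: eq_bigr => j _; rewrite /G; ring.
  by rewrite eig; field; rewrite gt_eqF.
have GE' : \sum_i \sum_j G j i = rho * \sum_i d i * x i ^+ 2.
  by rewrite -GE exchange_big.
have : 2 * quad x <= \sum_i \sum_j G i j + \sum_i \sum_j G j i.
  rewrite mulr_sumr -big_split; apply: ler_sum => i _ /=.
  rewrite mulr_sumr -big_split; apply: ler_sum => j _ /=.
  rewrite /G (adj_sym j i) -mulrDr mulrCA; apply: ler_wpM2l => //.
  have := w0 i; have := w0 j => wj wi.
  rewrite -subr_ge0 (_ : _ - _ = (x i * w j - x j * w i) ^+ 2 / (w i * w j)).
    by rewrite divr_ge0 ?sqr_ge0 // mulr_ge0 // ltW.
  by field; rewrite !gt_eqF.
by rewrite GE GE'; lra.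
Qed.

(** [eigenvalue] refers to row vectors. With [d = deg / g], the substitution [v = d x] turns
    [v M = a v] into [A x = a d x]; there [w] realizes [rho], and [quad_le] shows that no eigenvalue
    exceeds it. *)
Lemma lambda_maxE (g w : 'I_n -> R) (rho : R) (i0 : 'I_n) :
  (forall i, 0 < g i) -> (forall i, 0 < w i) ->
  (forall i, g i * mu A w i = rho * w i) ->
  lambda_max (\matrix_(i, j) (g i * Wmx A i j)) = rho.
Proof.
move=> g0 w0 eig; pose d i := deg A i / g i.
have d0 i : 0 < d i by rewrite divr_gt0 ?deg_gt0.
have eigd i : \sum_j A i j * w j = rho * (d i * w i).
  have := eig i; rewrite /mu => e.
  rewrite mulrCA -e /d; field; rewrite !gt_eqF ?deg_gt0 //=.
set M := (M in lambda_max M).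
have actM (v : 'rV[R]_n) j : (v *m M) ord0 j = \sum_i A j i * (v ord0 i / d i).
  rewrite mxE; apply: eq_bigr => i _; rewrite !mxE adj_sym /d.
  by field; rewrite !gt_eqF ?deg_gt0.
have uM : \row_i (d i * w i) *m M = rho *: \row_i (d i * w i).
  apply/rowP => j; rewrite actM !mxE -eigd; apply: eq_bigr => i _.
  by rewrite mxE; field; rewrite !gt_eqF.
have eigM : [set a | eigenvalue M a] rho.
  apply/eigenvalueP; exists (\row_i (d i * w i)) => //.
  apply/eqP => /rowP/(_ i0); rewrite !mxE => /eqP.
  by rewrite mulf_eq0 !gt_eqF.
have ubM : ubound [set a : R | eigenvalue M a] rho.
  move=> a /eigenvalueP[v vM v0].
  pose x i := v ord0 i / d i.
  have := quad_le _ _ _ w0 eigd x.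
  have -> : quad x = a * \sum_i d i * x i ^+ 2.
    rewrite mulr_sumr; apply: eq_bigr => i _.
    transitivity (x i * \sum_j A i j * x j).
      by rewrite mulr_sumr; apply: eq_bigr => j _; ring.
    by rewrite -actM vM mxE /x; field; rewrite gt_eqF.
  rewrite ler_pM2r //.
  have [i vi] : exists i, v ord0 i != 0.
    apply: contrapT => /forallNP v0'; move/eqP: v0; apply; apply/rowP => i.
    by rewrite mxE; apply/eqP; have /negP := v0' i; rewrite negbK.
  rewrite (bigD1 i) //=; apply: ltr_pwDl; last first.
    by apply: sumr_ge0 => j _; rewrite mulr_ge0 ?sqr_ge0 ?ltW.
  by rewrite mulr_gt0 // exprn_even_gt0 //= mulf_neq0 ?invr_neq0 // gt_eqF.
apply/eqP; rewrite eq_le; apply/andP; split.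
  by apply: ge_sup => //; exists rho.
by apply: ub_le_sup => //; exists rho.
Qed.


End Graph.
Arguments quad {R n} A x.

(** * The response function *)

Section Response.
Context {R : realType}.
Implicit Types x y g : R.

Lemma f_den_gt0 x g : 0 < g -> 0 <= x <= 1 -> 0 < 1 + (g - 1) * x.
Proof. by move=> g0 /andP[x0 x1]; have [?|?] := leP x (1/2); nra. Qed.

Lemma f_ge0 x g : 0 < g -> 0 <= x <= 1 -> 0 <= f x g.
Proof.
move=> g0 x01; have D := f_den_gt0 _ _ g0 x01; have /andP[x0 _] := x01.
by rewrite divr_ge0 ?mulr_ge0 // ltW.
Qed.

(** Exchanging the two opinions inverts the bias. This carries results from one corner to the other
    and, in [f_itv], turns [f >= 0] into [f <= 1]. *)
Lemma f_flip x g : 0 < g -> 0 <= x <= 1 -> f (1 - x) g^-1 = 1 - f x g.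
Proof.
move=> g0 x01; have D := f_den_gt0 _ _ g0 x01.
by rewrite /f; field; rewrite ?gt_eqF //=.
Qed.

Lemma f_itv x g : 0 < g -> 0 <= x <= 1 -> 0 <= f x g <= 1.
Proof.
move=> g0 x01; rewrite f_ge0 //= -subr_ge0 -f_flip // f_ge0 ?invr_gt0 //.
by case/andP: x01; lra.
Qed.

(** One explicit difference serves both monotonicity and the Lipschitz bound. *)
Lemma f_sub x y g : 0 < g -> 0 <= x <= 1 -> 0 <= y <= 1 ->
  f y g - f x g = g * (y - x) / ((1 + (g - 1) * x) * (1 + (g - 1) * y)).
Proof.
move=> g0 x01 y01; have Dx := f_den_gt0 _ _ g0 x01; have Dy := f_den_gt0 _ _ g0 y01.
by rewrite /f; field; rewrite !gt_eqF.
Qed.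

Lemma f_le x y g : 0 < g -> 0 <= x -> x <= y -> y <= 1 -> f x g <= f y g.
Proof.
move=> g0 x0 xy y1; have x01 : 0 <= x <= 1 by lra.
have y01 : 0 <= y <= 1 by lra.
rewrite -subr_ge0 f_sub // divr_ge0 ?mulr_ge0 ?subr_ge0 //; try exact: ltW.
  exact/ltW/f_den_gt0.
exact/ltW/f_den_gt0.
Qed.

Lemma f_lipschitz g : 0 < g -> exists2 L, 0 < L &
  forall x y, 0 <= x -> x <= y -> y <= 1 -> f y g - f x g <= L * (y - x).
Proof.
(* The denominator [1 + (g - 1) x] is a convex combination of [1] and [g], hence at least [m]. *)
move=> g0; pose m := Num.min 1 g.
have m0 : 0 < m by rewrite lt_min g0 ltr01.
have [m1 mg] : m <= 1 /\ m <= g by rewrite !ge_min !lexx orbT.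
exists (g / m ^+ 2); first by rewrite divr_gt0 ?exprn_gt0.
move=> x y x0 xy y1; have x01 : 0 <= x <= 1 by lra.
have y01 : 0 <= y <= 1 by lra.
have Dm z : 0 <= z <= 1 -> m <= 1 + (g - 1) * z by move=> /andP[? ?]; nra.
rewrite f_sub // mulrAC; apply: ler_wpM2r; first by rewrite subr_ge0.
apply: ler_wpM2l; first exact: ltW.
rewrite lef_pV2 ?posrE ?exprn_gt0 ?mulr_gt0 ?f_den_gt0 // expr2.
by apply: ler_pM; rewrite ?(ltW m0) // Dm.
Qed.

(** Near [0] the response dominates lines of slope slightly below its derivative [g]; [delta] is a
    range on which the slope [kappa g] is low enough. *)
Lemma f_ge_lin x g kappa delta : 0 < g -> 0 <= x -> x <= delta -> delta <= 1 ->
  0 < kappa -> kappa * (1 + `|g - 1| * delta) <= 1 -> kappa * (g * x) <= f x g.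
Proof.
move=> g0 x0 xd d1 k0 kd; have x01 : 0 <= x <= 1 by lra.
have D := f_den_gt0 _ _ g0 x01.
rewrite /f ler_pdivlMr // mulrAC; apply: ler_piMl; first by rewrite mulr_ge0 // ltW.
apply: le_trans kd; rewrite ler_pM2l // lerD2l.
apply: le_trans (ler_wpM2l (normr_ge0 _) xd).
by apply: ler_wpM2r => //; apply: ler_norm.
Qed.

End Response.

(** * Neighbourhood means, subsolutions and the spectra at the two corners *)

Section Mean.
Context {R : realType} {n : nat} {A : 'M[R]_n}.
Hypothesis Asym : A^T = A.
Hypothesis A_ge0 : forall i j, 0 <= A i j.
Hypothesis Aconn : graph_connected A.
Hypothesis Anbip : ~ graph_bipartite A.
Implicit Types b w gamma : 'I_n -> R.

Let dgt0 := deg_gt0 A_ge0 Aconn Anbip.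

Lemma muE b i : deg A i * mu A b i = \sum_j A i j * b j.
Proof. by rewrite /mu mulrA mulfV ?mul1r // gt_eqF. Qed.

Lemma mu_cst c i : mu A (fun=> c) i = c.
Proof. by rewrite /mu -mulr_suml -/(deg A i) mulrA mulVf ?mul1r // gt_eqF. Qed.

Lemma muD b w i : mu A (fun j => b j + w j) i = mu A b i + mu A w i.
Proof.
by rewrite /mu -mulrDr; congr *%R; rewrite -big_split; apply: eq_bigr => j _; rewrite mulrDr.
Qed.

Lemma muZ c b i : mu A (fun j => c * b j) i = c * mu A b i.
Proof.
rewrite /mu mulrCA; congr *%R; rewrite mulr_sumr.
by apply: eq_bigr => j _; rewrite mulrCA.
Qed.

Lemma mu_flip b i : mu A (fun j => 1 - b j) i = 1 - mu A b i.
Proof.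
have -> : (fun j => 1 - b j) = (fun j => 1 + -1 * b j).
  by apply/funext => j; rewrite mulN1r.
by rewrite muD muZ mu_cst mulN1r.
Qed.

Lemma mu_le b w i : (forall j, b j <= w j) -> mu A b i <= mu A w i.
Proof.
move=> bw; apply: ler_wpM2l; first by rewrite invr_ge0 ltW.
by apply: ler_sum => j _; apply: ler_wpM2l.
Qed.

Lemma mu_itv b i : (forall j, 0 <= b j <= 1) -> 0 <= mu A b i <= 1.
Proof.
move=> b01; apply/andP; split.
  by rewrite -(mu_cst 0 i); apply: mu_le => j; case/andP: (b01 j).
by rewrite -(mu_cst 1 i); apply: mu_le => j; case/andP: (b01 j).
Qed.

Lemma mu_lt1 b i : (forall j, b j < 1) -> mu A b i < 1.
Proof.
move=> b1; rewrite -subr_gt0 -mu_flip lt_def; apply/andP; split; last first.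
  by rewrite -(mu_cst 0 i); apply: mu_le => j; rewrite subr_ge0 ltW.
rewrite mulf_neq0 ?invr_neq0 ?gt_eqF // lt_def; apply/andP; split; last first.
  by apply: sumr_ge0 => j _; rewrite mulr_ge0 // subr_ge0 ltW.
apply/negP; rewrite psumr_eq0 => [/allP z|j _]; last by rewrite mulr_ge0 // subr_ge0 ltW.
have := dgt0 i; rewrite /deg big1 ?ltxx // => j _.
by have := z j (mem_index_enum _); rewrite mulf_eq0 subr_eq0 (gt_eqF (b1 j)) orbF => /eqP.
Qed.

(** The map F of the overview. *)
Definition resp gamma b i := f (mu A b i) (gamma i).

Lemma resp_itv gamma b i : (forall j, 0 < gamma j) -> (forall j, 0 <= b j <= 1) ->
  0 <= resp gamma b i <= 1.
Proof. by move=> g0 b01; apply: f_itv => //; apply: mu_itv. Qed.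

(** In odds, the response multiplies [m / (1 - m)] by [gamma]. The pairing uses [u = w deg / gamma],
    a left eigenvector of [J0]. [slack] adds two nonnegative defects, Jensen's and that of the
    subsolution; its total is [rho - 1] times a nonnegative sum, so both defects vanish
    everywhere. *)
Lemma subsolution_eq0 gamma w rho b :
  (forall i, 0 < gamma i) -> (exists i, gamma i != 1) -> (forall i, 0 < w i) ->
  (forall i, gamma i * mu A w i = rho * w i) -> rho <= 1 ->
  (forall i, 0 <= b i < 1) -> (forall i, b i <= resp gamma b i) ->
  forall i, b i = 0.
Proof.
move=> g0 [i0 gi0] w0 eig rho1 b01 sub.
pose m := mu A b; pose o i := b i / (1 - b i).
have b_ge0 i : 0 <= b i by case/andP: (b01 i).
have b_lt1 i : 0 < 1 - b i by case/andP: (b01 i); rewrite subr_gt0.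
have o_ge0 i : 0 <= o i by rewrite divr_ge0 // ltW.
have m_ge0 i : 0 <= m i.
  by rewrite -(mu_cst 0 i); apply: mu_le => j.
have m_lt1 i : 0 < 1 - m i.
  by rewrite subr_gt0; apply: mu_lt1 => j; case/andP: (b01 j).
have o_le i : o i <= gamma i * (m i / (1 - m i)).
  rewrite mulrA /o ler_pdivrMr // mulrAC ler_pdivlMr //.
  have := sub i; rewrite /resp /f -/(m i) ler_pdivlMr; first by lra.
  by apply: f_den_gt0; rewrite // m_ge0 -subr_ge0 ltW.
pose gap i := \sum_j A i j * ((b j - m i) ^+ 2 / ((1 - m i) ^+ 2 * (1 - b j))).
have gap_term_ge0 i j : 0 <= A i j * ((b j - m i) ^+ 2 / ((1 - m i) ^+ 2 * (1 - b j))).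
  by rewrite mulr_ge0 // divr_ge0 ?sqr_ge0 // mulr_ge0 ?sqr_ge0 // ltW.
have gap_ge0 i : 0 <= gap i by apply: sumr_ge0.
(* second-order Taylor expansion of x / (1 - x) at the mean, with exact remainder *)
have jensen i : \sum_j A i j * o j = deg A i * (m i / (1 - m i)) + gap i.
  have e : \sum_j A i j * (b j - m i) = 0.
    under eq_bigr do rewrite mulrBr.
    by rewrite sumrB -muE -mulr_suml -/(deg A i) subrr.
  transitivity (deg A i * (m i / (1 - m i)) +
                (\sum_j A i j * (b j - m i)) / (1 - m i) ^+ 2 + gap i); last first.
    by rewrite e mul0r addr0.
  rewrite /deg !mulr_suml /gap -!big_split; apply: eq_bigr => j _ /=.
  by rewrite /o; field; rewrite !gt_eqF.
pose u i := w i * deg A i / gamma i.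
have u_gt0 i : 0 < u i by rewrite divr_gt0 // mulr_gt0.
have swap : \sum_i w i * \sum_j A i j * o j = rho * \sum_i u i * o i.
  transitivity (\sum_j o j * \sum_i A j i * w i).
    transitivity (\sum_i \sum_j w i * (A i j * o j)).
      by apply: eq_bigr => i _; rewrite mulr_sumr.
    rewrite exchange_big; apply: eq_bigr => j _ /=; rewrite mulr_sumr.
    by apply: eq_bigr => i _; rewrite (adj_sym Asym i j); ring.
  rewrite mulr_sumr; apply: eq_bigr => j _; rewrite -muE.
  have := eig j => e; have -> : mu A w j = rho * w j / gamma j.
    by rewrite -e mulrAC mulfV ?mul1r // gt_eqF.
  by rewrite /u; ring.
pose slack i := w i * gap i + (w i * deg A i * (m i / (1 - m i)) - u i * o i).
have slack2_ge0 i : 0 <= w i * deg A i * (m i / (1 - m i)) - u i * o i.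
  rewrite subr_ge0; apply: (le_trans (ler_wpM2l (ltW (u_gt0 i)) (o_le i))).
  rewrite (_ : u i * _ = w i * deg A i * (m i / (1 - m i))) // /u.
  by field; rewrite !gt_eqF.
have slack_ge0 i : 0 <= slack i.
  by rewrite addr_ge0 // mulr_ge0 // ltW.
have slack_sum : \sum_i slack i <= 0.
  have -> : \sum_i slack i = (rho - 1) * \sum_i u i * o i.
    rewrite mulrBl -swap mul1r -sumrB; apply: eq_bigr => i _.
    by rewrite jensen /slack; ring.
  rewrite mulr_le0_ge0 ?subr_le0 //.
  by apply: sumr_ge0 => i _; rewrite mulr_ge0 // ltW.
have slack0 i : slack i = 0.
  have /eqP : \sum_i slack i = 0.
    by apply/eqP; rewrite eq_le slack_sum sumr_ge0.
  by rewrite psumr_eq0 // => /allP/(_ i (mem_index_enum _)) /eqP.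
have wgap_ge0 i : 0 <= w i * gap i by rewrite mulr_ge0 // ltW.
have gap0 i : gap i = 0.
  have : w i * gap i = 0.
    by have := slack0 i; have := wgap_ge0 i; have := slack2_ge0 i; rewrite /slack; lra.
  by move=> /eqP; rewrite mulf_eq0 gt_eqF //= => /eqP.
have oE i : o i = gamma i * (m i / (1 - m i)).
  have : w i * deg A i * (m i / (1 - m i)) - u i * o i = 0.
    by have := slack0 i; rewrite /slack gap0 mulr0 add0r.
  move=> /eqP; rewrite subr_eq0 => /eqP e.
  apply: (mulfI (x := u i)); first by rewrite gt_eqF.
  by rewrite -e /u; field; rewrite !gt_eqF.
(* The gap is a sum of squares weighted by [A], so its vanishing puts [b j] at the mean [m i] for
   every edge. *)
have edgeE i j : edge A i j -> b j = m i.
  move=> eij; have /eqP := gap0 i; rewrite psumr_eq0 // => /allP/(_ j (mem_index_enum _)).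
  rewrite mulf_eq0 gt_eqF //= mulf_eq0 invr_eq0 sqrf_eq0 subr_eq0.
  by rewrite [X in _ || X]gt_eqF ?orbF => [/eqP//|]; rewrite mulr_gt0 ?exprn_gt0.
have cst := edge_const Asym Aconn Anbip b m edgeE.
(* The odds are constant by now, and multiplication by [gamma i0 != 1] fixes only [0]. *)
have oi0 : o i0 = gamma i0 * o i0.
  by rewrite [LHS]oE (cst i0 i0).2.
have /eqP : (1 - gamma i0) * o i0 = 0 by rewrite mulrBl mul1r -oi0 subrr.
rewrite mulf_eq0 subr_eq0 eq_sym (negbTE gi0) /= mulf_eq0 invr_eq0.
rewrite [X in _ || X]gt_eqF // orbF => /eqP bi0 i.
by rewrite (cst i i0).1.
Qed.

(** If both eigenvalues were at most [1], the values of [quad] at [s = sqrt gamma] and at [1 / s]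
    would each be at most the total degree [D]. As [s_i s_j + 1 / (s_i s_j) >= 2], their sum is at
    least [2 D]; hence [s_i s_j = 1] on edges, and [edge_const] yields [gamma = 1]. *)
Lemma eig_inv_gt1 gamma w rho w' rho' :
  (forall i, 0 < gamma i) -> (exists i, gamma i != 1) ->
  (forall i, 0 < w i) -> (forall i, gamma i * mu A w i = rho * w i) -> rho <= 1 ->
  (forall i, 0 < w' i) -> (forall i, (gamma i)^-1 * mu A w' i = rho' * w' i) ->
  1 < rho'.
Proof.
move=> g0 [i0 gi0] w0 eig rho1 w'0 eig'; rewrite ltNge; apply/negP => rho'1.
have dg i : deg A i != 0 by rewrite gt_eqF.
have gg i : gamma i != 0 by rewrite gt_eqF.
have eq1 i : \sum_j A i j * w j = rho * (deg A i / gamma i * w i).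
  rewrite -muE [RHS]mulrCA -eig; by field.
have eq2 i : \sum_j A i j * w' j = rho' * (deg A i * gamma i * w' i).
  rewrite -muE [RHS]mulrCA -eig'; by field.
pose s i := Num.sqrt (gamma i).
have s0 i : 0 < s i by rewrite sqrtr_gt0.
have s2 i : s i ^+ 2 = gamma i by rewrite sqr_sqrtr // ltW.
pose D := \sum_i deg A i.
have D_ge0 : 0 <= D by apply: sumr_ge0 => i _; exact: ltW.
have q1 : quad A s <= D.
  apply: (le_trans (quad_le Asym A_ge0 _ _ _ w0 eq1 s)).
  rewrite (eq_bigr (fun i => deg A i)) => [|i _]; last by rewrite s2 divfK.
  by rewrite -/D ler_piMl.
have q2 : quad A (fun i => (s i)^-1) <= D.
  apply: (le_trans (quad_le Asym A_ge0 _ _ _ w'0 eq2 _)).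
  rewrite (eq_bigr (fun i => deg A i)) => [|i _]; last by rewrite exprVn s2 mulfK.
  by rewrite -/D ler_piMl.
pose G i j := A i j * ((s i * s j - 1) ^+ 2 / (s i * s j)).
have G_ge0 i j : 0 <= G i j.
  by rewrite mulr_ge0 // divr_ge0 ?sqr_ge0 // mulr_ge0 // ltW.
have GE : \sum_i \sum_j G i j = quad A s + quad A (fun i => (s i)^-1) - 2 * D.
  rewrite /quad /D mulr_sumr -big_split -sumrB; apply: eq_bigr => i _ /=.
  rewrite /deg mulr_sumr -big_split -sumrB; apply: eq_bigr => j _ /=.
  by rewrite /G; field; rewrite !gt_eqF.
have edgeE i j : edge A i j -> s j = (s i)^-1.
  move=> eij.
  have /eqP : \sum_i \sum_j G i j = 0.
    apply/eqP; rewrite eq_le; apply/andP; split; first by rewrite GE; lra.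
    by apply: sumr_ge0 => k _; apply: sumr_ge0.
  rewrite psumr_eq0 => [/allP/(_ i (mem_index_enum _))/=|k _]; last exact: sumr_ge0.
  rewrite psumr_eq0 // => /allP/(_ j (mem_index_enum _))/=.
  rewrite mulf_eq0 gt_eqF //= mulf_eq0 invr_eq0 sqrf_eq0 subr_eq0.
  rewrite [X in _ || X]gt_eqF ?orbF; last by rewrite mulr_gt0.
  by move=> /eqP e; rewrite -[LHS](mulKf (lt0r_neq0 (s0 i))) e mulr1.
have [_ e] := edge_const Asym Aconn Anbip s (fun i => (s i)^-1) edgeE i0 i0.
move/eqP: gi0; apply; rewrite -s2 expr2 -{1}e mulVf // gt_eqF //.
Qed.

End Mean.
Arguments resp {R n} A gamma b i.

(** * Deterministic estimates along a trajectory *)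

Lemma pos_lower_bound {R : realType} {n} (w : 'I_n -> R) :
  (forall i, 0 < w i) -> exists2 m, 0 < m & forall i, m <= w i.
Proof.
move=> w0; pose s := \sum_j (w j)^-1.
have s0 : 0 <= s by apply: sumr_ge0 => j _; rewrite invr_ge0 ltW.
(* The reciprocal of a sum replaces a minimum, which would require ['I_n] to be nonempty. *)
exists (1 + s)^-1 => [|i]; first by rewrite invr_gt0 ltr_pwDl.
rewrite -[w i]invrK lef_pV2 ?posrE ?invr_gt0 ?ltr_pwDl // /s (bigD1 i) //=.
have : 0 <= \sum_(j | j != i) (w j)^-1.
  by apply: sumr_ge0 => j _; rewrite invr_ge0 ltW.
by lra.
Qed.

Lemma near_le_mulSn {R : realType} (C e : R) : 0 < e ->
  \forall k \near \oo, C <= e * k.+1%:R.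
Proof.
move=> e0; near=> k.
have : C / e <= k%:R by near: k; apply: nbhs_infty_ger.
by rewrite ler_pdivrMr // -natr1; lra.
Unshelve. all: by end_near. Qed.

(** The harmonic series diverges. Used by contradiction: a nonnegative expected potential cannot
    keep dropping by [c / (k + 1)], so there are late times at which it does not. *)
Lemma harmonic_descent {R : realType} (e : nat -> R) (c : R) m : 0 < c ->
  (forall k, (m <= k)%N -> 0 <= e k) ->
  (forall k, (m <= k)%N -> e k.+1 <= e k - c / k.+1%:R) -> False.
Proof.
move=> c0 e_ge0 e_desc; pose H := series (@harmonic R).
have HS k : H k.+1 = H k + k.+1%:R^-1 by rewrite /H /series /= big_nat_recr.
have e_le l : e (m + l)%N <= e m + c * H m - c * H (m + l)%N.
  elim: l => [|l IH]; first by rewrite addn0 addrK.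
  rewrite addnS HS mulrDr opprD addrA; apply: le_trans (e_desc _ (leq_addr _ _)) _.
  by rewrite lerD2r.
have Hoo : H @ \oo --> +oo.
  apply: nondecreasing_dvgn_lt; last exact: dvg_harmonic.
  by apply/nondecreasing_seqP => k; rewrite HS lerDl invr_ge0.
have := (cvgryPgt _).1 Hoo (e m / c + H m) => -[N _ hN].
have := hN (m + N)%N (leq_addl _ _) => /=.
rewrite -(ltr_pM2l c0) mulrDr mulrCA mulfV ?gt_eqF // mulr1.
by have := e_le N; have := e_ge0 (m + N)%N (leq_addr _ _); lra.
Qed.

Lemma negligible_of_small {R : realType} {d} {T : measurableType d}
    (P : {measure set T -> \bar R}) (N : set T) :
  (forall eta : R, 0 < eta -> exists B,
    [/\ measurable B, (P B <= eta%:E)%E & N `<=` B]) -> P.-negligible N.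
Proof.
move=> small.
have small' (j : nat) : {B | [/\ measurable B, (P B <= (j.+1%:R^-1 : R)%:E)%E & N `<=` B]}.
  by apply/cid/small; rewrite invr_gt0.
pose B j := sval (small' j); have HB j := svalP (small' j).
have mB : measurable (\bigcap_j B j) by apply: bigcapT_measurable => j; case: (HB j).
exists (\bigcap_j B j); split => //; last by move=> z Nz j _; case: (HB j) => _ _; exact.
apply/eqP; rewrite eq_le measure_ge0 andbT; apply/lee_addgt0Pr => e e0.
rewrite add0e; have [j je] : exists j : nat, j.+1%:R^-1 <= e.
  exists (Num.truncn e^-1); rewrite -[leRHS]invrK lef_pV2 ?posrE ?invr_gt0 //.
  by rewrite ltW // truncnS_gt.
have [mBj PBj _] := HB j; apply: (@le_trans _ _ (P (B j))).
  by apply: le_measure; rewrite ?inE //; exact: bigcap_inf.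
by apply: le_trans PBj _; rewrite lee_fin.
Qed.

(** * Sample paths with negligible noise *)

Section Paths.
Context {R : realType} {n : nat} {A : 'M[R]_n}.
Hypothesis Asym : A^T = A.
Hypothesis A_ge0 : forall i j, 0 <= A i j.
Hypothesis Aconn : graph_connected A.
Hypothesis Anbip : ~ graph_bipartite A.
Variables gamma b1 : 'I_n -> R.
Hypothesis gamma_gt0 : forall i, 0 < gamma i.
Hypothesis b1_itv : forall i, 0 < b1 i < 1.
Implicit Type h : nat -> 'I_n -> bool.

Let mu_le := mu_le A_ge0 Aconn Anbip.

(** Index [k] is time k+1: the initial value weighs as one declaration, and the [k] actual ones are
    stored from index [2] on. *)
Lemma betaS_sum h k i :
  k.+1%:R * betaS b1 h k i = b1 i + \sum_(s < k) (h s.+2 i)%:R.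
Proof.
elim: k => [|k IH]; first by rewrite big_ord0 mul1r addr0.
rewrite big_ord_recr /= addrA -IH.
have k0 : 0 <= k%:R :> R by [].
by rewrite -!natr1; field; rewrite !gt_eqF //; lra.
Qed.

Lemma betaS_ge h k i : b1 i / k.+1%:R <= betaS b1 h k i.
Proof.
rewrite ler_pdivrMr ?ltr0n // mulrC betaS_sum lerDl.
by apply: sumr_ge0 => s _; rewrite ler0n.
Qed.

Lemma betaS_gt0 h k i : 0 < betaS b1 h k i.
Proof.
apply: lt_le_trans (betaS_ge h k i); rewrite divr_gt0 ?ltr0n //.
by case/andP: (b1_itv i).
Qed.

Lemma betaS_lt1 h k i : betaS b1 h k i < 1.
Proof.
have : k.+1%:R * betaS b1 h k i < k.+1%:R * 1.
  rewrite betaS_sum mulr1 -add1n natrD; apply: ltr_leD.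
    by case/andP: (b1_itv i).
  rewrite -[k in leRHS]card_ord -sumr_const; apply: ler_sum => s _.
  by rewrite lern1 leq_b1.
by rewrite ltr_pM2l ?ltr0n.
Qed.

Lemma betaS_itv h k i : 0 <= betaS b1 h k i <= 1.
Proof. by rewrite !ltW ?betaS_gt0 ?betaS_lt1. Qed.

Lemma resp_betaS_itv h k i : 0 <= resp A gamma (betaS b1 h k) i <= 1.
Proof. by apply: resp_itv => // j; apply: betaS_itv. Qed.

(** Under the law of the process this is a martingale: declarations minus their conditional
    means. *)
Definition noise h k i : R :=
  \sum_(s < k) ((h s.+2 i)%:R - resp A gamma (betaS b1 h s) i).

Lemma betaS_noise h k i : k.+1%:R * betaS b1 h k i =
  b1 i + \sum_(s < k) resp A gamma (betaS b1 h s) i + noise h k i.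
Proof. by rewrite betaS_sum /noise sumrB; ring. Qed.

(** The conclusion of the strong law, isolated as a property of one path so that the estimates below
    are deterministic. *)
Definition quiet h := forall e : R, 0 < e ->
  \forall k \near \oo, forall i, `|noise h k i| <= e * k.+1%:R.

(** The state is the average of the past responses up to negligible noise. Hence its upper limit [b]
    satisfies [b <= F(b)], and [subsolution_eq0] applies because [b < 1]. *)
Lemma quiet_cvg0 (w : 'I_n -> R) (rho : R) h : (exists i, gamma i != 1) -> (forall i, 0 < w i) ->
  (forall i, gamma i * mu A w i = rho * w i) -> rho <= 1 -> quiet h ->
  (exists2 c : R, 0 < c & \forall k \near \oo, forall i, betaS b1 h k i <= 1 - c) ->
  forall i, (fun k => betaS b1 h k i) @ \oo --> (0 : R).
Proof.
move=> gne w0 eig rho1 qh [c c0 below1].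
(* The limsup is encoded as the infimum of the eventual upper bounds. *)
pose ub i := [set x : R | 0 <= x /\ \forall k \near \oo, betaS b1 h k i <= x].
have ub1 i : ub i 1.
  by split=> //; near=> k; case/andP: (betaS_itv h k i).
have ub_inf i : has_inf (ub i) by split; [exists 1|exists 0 => x []].
pose b i := inf (ub i).
have b_le i x : ub i x -> b i <= x by move=> ?; apply: ge_inf => //; exact: (ub_inf i).2.
have b_ge0 i : 0 <= b i by apply: lb_le_inf => [|x []//]; exists 1.
have b_near e : 0 < e -> \forall k \near \oo, forall i, betaS b1 h k i <= b i + e.
  move=> e0; apply: filter_forall => i.
  have [x [_ xub] xb] := inf_adherent e0 (ub_inf i).
  near=> k; apply: le_trans (ltW xb); near: k; exact: xub.
have b_lt1 i : b i < 1.
  (* Members of [ub] are nonnegative, while [c] is not known to be at most [1]. *)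
  apply: (@le_lt_trans _ _ (Num.max 0 (1 - c))); last by rewrite gt_max ltr01; lra.
  apply: b_le; split; first by rewrite le_max lexx.
  near=> k; rewrite le_max; apply/orP; right.
  by near: k; apply: filterS below1 => k.
have b_itv i : 0 <= b i <= 1 by rewrite b_ge0 ltW.
have b_sub i : b i <= resp A gamma b i.
  have [L L0 lip] := f_lipschitz _ (gamma_gt0 i).
  (* Of the [L + 2] shares of [e'], [L] pay for the Lipschitz error, one for the noise, and one for
     the initial value and the first [K] responses. *)
  apply/ler_addgt0Pr => e' e'0; pose e := e' / (L + 2).
  have e0 : 0 < e by rewrite divr_gt0 // addr_gt0.
  have -> : e' = (L + 2) * e by rewrite /e; field; rewrite gt_eqF // addr_gt0.
  have /andP[r0 r1] := resp_itv A_ge0 Aconn Anbip _ _ i gamma_gt0 b_itv.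
  have [K _ hK] := b_near e e0.
  pose cc := resp A gamma b i + L * e.
  have cc0 : 0 <= cc by rewrite addr_ge0 // mulr_ge0 ?ltW.
  have step s : (K <= s)%N -> resp A gamma (betaS b1 h s) i <= cc.
    move=> Ks; have m01 := mu_itv A_ge0 Aconn Anbip b i b_itv.
    have := mu_itv A_ge0 Aconn Anbip _ i (betaS_itv h s) => /andP[x0 x1].
    have xb : mu A (betaS b1 h s) i <= mu A b i + e.
      rewrite -[e in leRHS](mu_cst A_ge0 Aconn Anbip e i) -muD; apply: mu_le => j.
      exact: hK.
    have [xm|mx] := leP (mu A (betaS b1 h s) i) (mu A b i).
      apply: (@le_trans _ _ (resp A gamma b i)).
        by apply: f_le => //; case/andP: m01.
      by rewrite lerDl mulr_ge0 ?ltW.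
    rewrite -lerBlDl; apply: (le_trans (lip _ _ _ (ltW mx) x1)).
      by case/andP: m01.
    by rewrite ler_pM2l //; lra.
  have sumK m : \sum_(s < K + m) resp A gamma (betaS b1 h s) i <= K%:R + m%:R * cc.
    elim: m => [|m IH].
      rewrite addn0 mul0r addr0 -[K in leRHS]card_ord -sumr_const.
      by apply: ler_sum => s _; case/andP: (resp_betaS_itv h s i).
    rewrite addnS big_ord_recr /= -natr1 mulrDl mul1r addrA.
    by apply: lerD => //; apply: step; apply: leq_addr.
  apply: b_le; split.
    by rewrite addr_ge0 // mulr_ge0 ?addr_ge0 // ltW.
  near=> k.
  have kK : (K <= k)%N by near: k; exact: nbhs_infty_ge.
  have Nk : `|noise h k i| <= e * k.+1%:R by near: k; apply: filterS (qh e e0) => k; exact.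
  have Ck : 1 + K%:R <= e * k.+1%:R by near: k; exact: near_le_mulSn.
  have k0 : 0 < k.+1%:R :> R by rewrite ltr0n.
  rewrite -(ler_pM2l k0) betaS_noise.
  have := sumK (k - K)%N; rewrite subnKC //.
  have kc : (k - K)%:R * cc <= k.+1%:R * cc.
    by apply: ler_wpM2r => //; rewrite ler_nat; apply: leq_trans (leq_subr _ _) _.
  have := ler_norm (noise h k i); have /andP[_ b11] := b1_itv i.
  rewrite /cc in kc * => ? ?; lra.
have b0 := subsolution_eq0 Asym A_ge0 Aconn Anbip _ _ _ b gamma_gt0 gne w0 eig rho1 _ b_sub.
move=> i; apply/cvgrPdist_le => e e0; near=> k.
rewrite sub0r normrN ger0_norm; last by case/andP: (betaS_itv h k i).
rewrite -[e]add0r -(b0 _ i); last by move=> j; rewrite b_ge0 b_lt1.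
by near: k; apply: filterS (b_near e e0) => k; exact.
Unshelve. all: by end_near. Qed.

(** A linear minorant common to all agents that is still supercritical, as [kappa rho > 1]. *)
Lemma linear_response (w : 'I_n -> R) (rho : R) : (forall i, 0 < w i) ->
  (forall i, gamma i * mu A w i = rho * w i) -> 1 < rho ->
  exists kappa delta : R, [/\ 0 < kappa, kappa < 1, 1 < kappa * rho,
    0 < delta <= 1 & forall x i, 0 <= x -> x <= delta ->
    kappa * (gamma i * x) <= f x (gamma i)].
Proof.
(* This value lies strictly between [1 / rho] and [1]. *)
move=> w0 eig rho1; pose kappa := 2 / (1 + rho).
have k0 : 0 < kappa by rewrite divr_gt0 //; lra.
have kE : kappa * (1 + rho) = 2 by rewrite /kappa; field; lra.
have k1 : kappa < 1 by nra.
pose G := \sum_i `|gamma i - 1|.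
have G0 : 0 <= G by exact: sumr_ge0.
(* It ensures [|gamma i - 1| delta <= 1 - kappa], which suffices since [kappa (2 - kappa) <= 1]. *)
pose delta := (1 - kappa) / (1 + G).
have G1 : 0 < 1 + G by rewrite ltr_pwDl.
have d0 : 0 < delta by rewrite divr_gt0 // subr_gt0.
have dE : delta * (1 + G) = 1 - kappa by rewrite /delta; field; rewrite gt_eqF.
have d1 : delta <= 1 by nra.
exists kappa, delta; split => //; [by nra|by rewrite d0|].
move=> x i x0 xd; apply: (f_ge_lin _ _ _ delta) => //.
have : `|gamma i - 1| <= G by rewrite /G (bigD1 i) //= lerDl sumr_ge0.
have := normr_ge0 (gamma i - 1); set z := `|_| => z0 zG.
have : z * delta <= 1 - kappa by nra.
by nra.
Qed.

(** On the box [beta >= sigma eps w] the responses are at least [kappa rho sigma eps w = eps w]. So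
    the average is pulled towards the smaller box, and the margin [(1 - sigma) eps w] absorbs the
    noise; the proof is a strong induction on time. *)
Lemma quiet_persist (w : 'I_n -> R) (rho : R) : (forall i, 0 < w i) ->
  (forall i, gamma i * mu A w i = rho * w i) -> 1 < rho ->
  exists eps0 sigma : R, [/\ 0 < eps0, 0 < sigma & forall eps h, 0 < eps -> eps <= eps0 ->
    quiet h -> \forall K \near \oo, (forall i, eps * w i <= betaS b1 h K i) ->
    forall k i, (K <= k)%N -> sigma * eps * w i <= betaS b1 h k i].
Proof.
move=> w0 eig rho1.
have [kappa [delta [k0 k1 kr /andP[d0 d1] flin]]] := linear_response w rho w0 eig rho1.
pose W := \sum_i w i; have W0 : 0 <= W by apply: sumr_ge0 => i _; exact: ltW.
have wW i : w i <= W by rewrite /W (bigD1 i) //= lerDl sumr_ge0 // => j _; exact: ltW.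
pose sigma := (kappa * rho)^-1.
have kr0 : 0 < kappa * rho by lra.
have s0 : 0 < sigma by rewrite invr_gt0.
have s1 : sigma < 1 by rewrite invf_lt1.
(* This bound on [eps] keeps [eps w] in the range of the linear minorant. *)
exists (delta / (1 + W)), sigma; split => //; first by rewrite divr_gt0 // ltr_pwDl.
move=> eps h e0 ele qh.
have eW : eps * (1 + W) <= delta by rewrite -ler_pdivlMr // ltr_pwDl.
have [m m0 mw] := pos_lower_bound _ w0.
(* Halved because the noise enters twice, at the entrance time [K] and at time [k]. *)
pose eta := (1 - sigma) * eps * m / 2.
have eta0 : 0 < eta by rewrite divr_gt0 // !mulr_gt0 // subr_gt0.
have [K0 _ hK0] := qh eta eta0.
near=> K => hK.
have KK0 : (K0 <= K)%N by near: K; exact: nbhs_infty_ge.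
have resp_ge s i : (forall j, sigma * eps * w j <= betaS b1 h s j) ->
    eps * w i <= resp A gamma (betaS b1 h s) i.
  move=> hs; have se0 : 0 < sigma * eps by rewrite mulr_gt0.
  pose x := mu A (fun j => sigma * eps * w j) i.
  have xE : x = sigma * eps * mu A w i by rewrite /x muZ.
  have x0 : 0 <= x.
    by rewrite -(mu_cst A_ge0 Aconn Anbip 0 i); apply: mu_le => j; rewrite mulr_ge0 // ltW.
  have xd : x <= delta.
    rewrite -(mu_cst A_ge0 Aconn Anbip delta i); apply: mu_le => j.
    have := wW j; have := w0 j => wj0 wjW; have : eps * w j <= delta by nra.
    rewrite -mulrA; have : 0 < eps * w j by rewrite mulr_gt0.
    by nra.
  apply: (@le_trans _ _ (f x (gamma i))); last first.
    apply: f_le => //; first exact: mu_le.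
    by have /andP[] := mu_itv A_ge0 Aconn Anbip _ i (betaS_itv h s).
  apply: le_trans (flin x i x0 xd).
  rewrite xE (_ : kappa * _ = kappa * sigma * eps * (gamma i * mu A w i)); last by ring.
  rewrite eig (_ : kappa * _ * _ * _ = (kappa * rho) * sigma * (eps * w i)); last by ring.
  by rewrite mulfV ?mul1r // gt_eqF.
suff H k : (K <= k)%N -> forall i, sigma * eps * w i <= betaS b1 h k i.
  by move=> k i Kk; exact: H.
elim/ltn_ind: k => k IH Kk i.
have sumk l : (K + l <= k)%N ->
    \sum_(s < K) resp A gamma (betaS b1 h s) i + l%:R * (eps * w i) <=
    \sum_(s < K + l) resp A gamma (betaS b1 h s) i.
  elim: l => [|l IHl] Klk; first by rewrite addn0 mul0r addr0.
  rewrite addnS big_ord_recr /= -natr1 mulrDl mul1r addrA.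
  rewrite addnS in Klk; apply: lerD; first exact/IHl/ltnW.
  by apply: resp_ge; apply: IH => //; exact: leq_addr.
have := sumk (k - K)%N; rewrite subnKC // => /(_ (leqnn _)) sumKk.
have k10 : 0 < k.+1%:R :> R by rewrite ltr0n.
have := betaS_noise h k i; have := betaS_noise h K i => eK ek.
have := hK0 K KK0 i; have := hK0 k (leq_trans KK0 Kk) i.
rewrite !ler_norml => /andP[Nk _] /andP[_ NK].
have Kk' : K.+1%:R <= k.+1%:R :> R by rewrite ler_nat.
have NK' : eta * K.+1%:R <= eta * k.+1%:R by rewrite ler_pM2l.
have hKi : K.+1%:R * (eps * w i) <= K.+1%:R * betaS b1 h K i.
  by rewrite ler_pM2l ?ltr0n.
have ksplit : (k - K)%:R * (eps * w i) + K.+1%:R * (eps * w i) = k.+1%:R * (eps * w i).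
  by rewrite -mulrDl -natrD addnS subnK.
have etaw : (1 - sigma) * (eps * w i) >= 2 * eta.
  rewrite /eta (_ : 2 * _ = (1 - sigma) * (eps * m)); last by field.
  by rewrite ler_pM2l ?subr_gt0 // ler_pM2l.
have etak : k.+1%:R * (2 * eta) <= k.+1%:R * ((1 - sigma) * (eps * w i)).
  by rewrite ler_pM2l.
rewrite -(ler_pM2l k10); lra.
Unshelve. all: by end_near. Qed.

End Paths.
Arguments noise {R n} A gamma b1 h k i.
Arguments quiet {R n} A gamma b1 h.

(** * The law of the process *)

Section Expectation.
Context {R : realType} {n : nat} {A : 'M[R]_n}.
Hypothesis Asym : A^T = A.
Hypothesis A_ge0 : forall i j, 0 <= A i j.
Hypothesis Aconn : graph_connected A.
Hypothesis Anbip : ~ graph_bipartite A.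
Variables gamma b1 : 'I_n -> R.
Hypothesis gamma_gt0 : forall i, 0 < gamma i.
Hypothesis b1_itv : forall i, 0 < b1 i < 1.
Implicit Types (h : nat -> 'I_n -> bool) (s : {ffun 'I_n -> bool}).
Implicit Types g : (nat -> 'I_n -> bool) -> R.

(* [betaS] reads its declarations from index 2 on, so the declaration following
   a history of length [m] sits at index [m.+2]. *)
Definition upd h m s : nat -> 'I_n -> bool := fun t => if t == m.+2 then s : _ -> _ else h t.

Lemma betaS_local h h' k : (forall t, (t < k)%N -> h t.+2 = h' t.+2) ->
  betaS b1 h k = betaS b1 h' k.
Proof.
elim: k => [//|k IH] hh'; apply/funext => i /=.
by rewrite IH ?hh' // => t tk; apply: hh'; apply: leq_trans tk _.
Qed.

Lemma upd_lt h m s t : (t < m)%N -> upd h m s t.+2 = h t.+2.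
Proof. by move=> tm; rewrite /upd !eqSS ltn_eqF. Qed.

Lemma upd_eq h m s : upd h m s m.+2 = s.
Proof. by rewrite /upd eqxx. Qed.

Lemma betaS_upd h m s k : (k <= m)%N -> betaS b1 (upd h m s) k = betaS b1 h k.
Proof.
by move=> km; apply: betaS_local => t tk; rewrite upd_lt // (leq_trans tk).
Qed.

(** The conditional law of the declarations that follow a history of length [m]; unfolding [resp]
    gives the product in the hypothesis of the theorem. *)
Definition kern h m (s : 'I_n -> bool) : R :=
  \prod_(i < n) bern (resp A gamma (betaS b1 h m) i) (s i).

Definition step m g h : R := \sum_(s : {ffun 'I_n -> bool}) kern h m s * g (upd h m s).

(* Conditional expectation of [g], [k] steps ahead, given a history of length [m]. *)
Fixpoint expect m k g : (nat -> 'I_n -> bool) -> R :=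
  if k is k'.+1 then step m (expect m.+1 k' g) else g.

Lemma kern_ge0 h m s : 0 <= kern h m s.
Proof.
apply: prodr_ge0 => i _.
have /andP[p0 p1] := resp_betaS_itv A_ge0 Aconn Anbip _ _ gamma_gt0 b1_itv h m i.
by rewrite /bern; case: (s i); rewrite ?subr_ge0.
Qed.

(** Distributing the product over the coordinates leaves total mass [1] in every factor but the
    [i]-th. *)
Lemma kern_marginal h m i (phi : bool -> R) :
  \sum_(s : {ffun 'I_n -> bool}) kern h m s * phi (s i) =
  resp A gamma (betaS b1 h m) i * phi true +
  (1 - resp A gamma (betaS b1 h m) i) * phi false.
Proof.
pose p := resp A gamma (betaS b1 h m).
pose G j c := bern (p j) c * (if j == i then phi c else 1).
transitivity (\sum_(s : {ffun 'I_n -> bool}) \prod_j G j (s j)).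
  apply: eq_bigr => s _; rewrite /G big_split /= -/(kern h m s); congr *%R.
  by rewrite (bigD1 i) //= eqxx big1 ?mulr1 // => j /negbTE ->.
rewrite -bigA_distr_bigA (bigD1 i) //= big_bool /G eqxx /=.
rewrite big1 ?mulr1 // => j /negbTE ji.
by rewrite big_bool ji /= !mulr1 addrC subrK.
Qed.

Lemma kern_sum h m : \sum_(s : {ffun 'I_n -> bool}) kern h m s = 1.
Proof.
case: (pickP (fun _ : 'I_n => true)) => [i _|no].
  have := kern_marginal h m i (fun=> 1); rewrite !mulr1 addrC subrK => <-.
  by apply: eq_bigr => s _; rewrite mulr1.
(* Without agents, the sum has a single term, an empty product. *)
rewrite (eq_bigr (fun=> 1)) => [|s _]; last first.
  by rewrite /kern big1 // => i; have := no i.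
by rewrite sumr_const card_ffun (eq_card0 (A := 'I_n)) // => i; have := no i.
Qed.

Lemma step_le m g g' h : (forall s, g (upd h m s) <= g' (upd h m s)) ->
  step m g h <= step m g' h.
Proof.
by move=> gg'; apply: ler_sum => s _; apply: ler_wpM2l; rewrite ?kern_ge0.
Qed.

Lemma step_linear m (a : R) g g' :
  step m (fun h => a * g h + g' h) = (fun h => a * step m g h + step m g' h).
Proof.
apply/funext => h; rewrite /step mulr_sumr -big_split; apply: eq_bigr => s _ /=.
by rewrite mulrDr mulrCA.
Qed.

Lemma step_cst m (c : R) : step m (fun=> c) = (fun=> c).
Proof. by apply/funext => h; rewrite /step -mulr_suml kern_sum mul1r. Qed.

Lemma expect_le m k g g' h : (forall h, g h <= g' h) ->
  expect m k g h <= expect m k g' h.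
Proof.
by move=> gg'; elim: k m h => //= k IH m h; apply: step_le => s; exact: IH.
Qed.

Lemma expect_linear m k (a : R) g g' :
  expect m k (fun h => a * g h + g' h) =
  (fun h => a * expect m k g h + expect m k g' h).
Proof. by elim: k m => //= k IH m; rewrite IH step_linear. Qed.

Lemma expect_cst m k (c : R) : expect m k (fun=> c) = (fun=> c).
Proof. by elim: k m => //= k IH m; rewrite IH step_cst. Qed.

(** [expect] recurses on the first step, whereas drift and variance estimates concern the last
    one. *)
Lemma expectSr m k g : expect m k.+1 g = expect m k (step (m + k) g).
Proof.
elim: k m => [|k IH] m; first by rewrite addn0.
by rewrite -[LHS]/(step m (expect m.+1 k.+1 g)) IH addSnnS.
Qed.

(** * Probabilities of events determined by finitely many declarations *)

Section Link.
Context {d : measure_display} {T : measurableType d} {P : probability T R}.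
Variable psi : nat -> 'I_n -> T -> bool.
Hypothesis psi_meas : forall t i, measurable [set w | psi t i w].
Hypothesis psi_law : forall (m : nat) h (s : 'I_n -> bool),
  P (hist_event psi m h `&` [set w | forall i, psi m.+2 i w = s i])
  = (P (hist_event psi m h) * (kern h m s)%:E)%E.

Definition decl w : nat -> 'I_n -> bool := fun t i => psi t i w.

Definition local k (B : set (nat -> 'I_n -> bool)) :=
  forall h h', (forall t, (t < k)%N -> h t.+2 = h' t.+2) -> B h -> B h'.

Lemma hist_eventS m h s : hist_event psi m.+1 (upd h m s) =
  hist_event psi m h `&` [set w | forall i, psi m.+2 i w = s i].
Proof.
apply/seteqP; split => w /=.
  move=> H; split=> [k km i|i]; first by rewrite H ?upd_lt // leqW.
  by rewrite H // upd_eq.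
move=> [H Hs] k; rewrite ltnS leq_eqVlt => /orP[/eqP->|km] i.
  by rewrite upd_eq.
by rewrite upd_lt // H.
Qed.

Lemma measurable_psi t i c : measurable [set w | psi t i w = c].
Proof.
case: c; first exact: psi_meas.
rewrite (_ : [set w | _] = ~` [set w | psi t i w]); first exact: measurableC.
by apply/seteqP; split => w /=; [move->|move/negP/negbTE].
Qed.

Lemma measurable_hist_event m h : measurable (hist_event psi m h).
Proof.
rewrite (_ : hist_event psi m h =
    \bigcap_(k in `I_m) \bigcap_(i in [set: 'I_n]) [set w | psi k.+2 i w = h k.+2 i]).
  apply: fin_bigcap_measurable => [|k _]; first exact: finite_II.
  apply: fin_bigcap_measurable => [|i _]; first exact: finite_finset.
  exact: measurable_psi.
by apply/seteqP; split=> w /= H k km i => [_|]; exact: H.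
Qed.

(** The hypothesis on the law speaks of cylinder events. Splitting on the next declaration, by
    induction on the number [k] of steps, extends it to all [local] events, whose probabilities
    become the finite sums [expect]. *)
Lemma prob_hist_local m k h B : local (m + k) B ->
  measurable (hist_event psi m h `&` [set w | B (decl w)]) /\
  P (hist_event psi m h `&` [set w | B (decl w)]) =
  (P (hist_event psi m h) * (expect m k \1_B h)%:E)%E.
Proof.
elim: k m h => [|k IH] m h locB.
  have pathE w : hist_event psi m h w -> forall t, (t < m)%N -> decl w t.+2 = h t.+2.
    by move=> H t tm; apply/funext => i; exact: H.
  rewrite addn0 in locB; rewrite /= indicE.
  have [Bh|nBh] := pselect (B h).
    rewrite mem_set // mule1 (_ : _ `&` _ = hist_event psi m h).
      by split=> //; exact: measurable_hist_event.
    apply/seteqP; split=> w; first by case.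
    move=> Hw; split=> //=; by apply: locB Bh => t tm; rewrite pathE.
  rewrite memNset // mule0 (_ : _ `&` _ = set0); first by rewrite measure0; split=> //; exact: measurable0.
  apply/seteqP; split=> w //; case=> Hw Bw; apply: nBh.
  by apply: locB Bw => t tm; rewrite pathE.
pose F s := hist_event psi m.+1 (upd h m s) `&` [set w | B (decl w)].
have FE : hist_event psi m h `&` [set w | B (decl w)] = \bigcup_(s in setT) F s.
  apply/seteqP; split=> w /=.
    move=> [Hw Bw]; exists [ffun i => psi m.+2 i w] => //; split=> //.
    by rewrite hist_eventS; split=> //= i; rewrite ffunE.
  by move=> [s _ [+ Bw]]; rewrite hist_eventS => -[Hw _]; split.
have IHs s := IH m.+1 (upd h m s); rewrite addSnnS in IHs.
have mF s : measurable (F s) by have [] := IHs s locB.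
have PF s : P (F s) = (P (hist_event psi m h) *
    (kern h m s * expect m.+1 k \1_B (upd h m s))%:E)%E.
  have [_ ->] := IHs s locB.
  by rewrite hist_eventS psi_law EFinM muleA.
rewrite FE; split; first by apply: fin_bigcup_measurable => //; exact: finite_finset.
have trivF : trivIset setT F.
  move=> s s' _ _ [w [[+ _] [+ _]]]; rewrite !hist_eventS => -[_ Hs] [_ Hs'].
  by apply/ffunP => i; rewrite -Hs Hs'.
rewrite measure_fin_bigcup //; last exact: finite_finset.
rewrite (_ : [set: {ffun 'I_n -> bool}] = [set` index_enum _]); last first.
  by apply/seteqP; split=> s //= _; exact: mem_index_enum.
rewrite -fsbig_seq ?index_enum_uniq //= (eq_bigr _ (fun s _ => PF s)).
have /fineK <- : P (hist_event psi m h) \is a fin_num.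
  exact/fin_num_measure/measurable_hist_event.
under eq_bigr do rewrite -EFinM.
by rewrite sumEFin -EFinM /step mulr_sumr.
Qed.

Lemma prob_local k B : local k B -> measurable [set w | B (decl w)] /\
  P [set w | B (decl w)] = (expect 0 k \1_B (fun _ _ => false))%:E.
Proof.
move=> locB; have := prob_hist_local 0 k (fun _ _ => false) B locB.
rewrite (_ : hist_event psi 0 _ = setT) ?setTI ?probability_setT ?mul1e //.
by apply/seteqP; split.
Qed.

Lemma prob_le k B g : local k B -> (forall h, \1_B h <= g h) ->
  (P [set w | B (decl w)] <= (expect 0 k g (fun _ _ => false))%:E)%E.
Proof.
by move=> /prob_local[_ ->] Bg; rewrite lee_fin; exact: expect_le.
Qed.

(** * Strong law of large numbers for the noise *)

Lemma noise_local h h' k : (forall t, (t < k)%N -> h t.+2 = h' t.+2) ->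
  noise A gamma b1 h k = noise A gamma b1 h' k.
Proof.
move=> hh'; apply/funext => i; apply: eq_bigr => t _.
rewrite hh' //; congr (_ - _); rewrite /resp; congr (f (mu A _ i) _).
by apply: betaS_local => t' t't; apply: hh'; apply: ltn_trans t't _.
Qed.

Lemma noise_upd h k s i : noise A gamma b1 (upd h k s) k.+1 i =
  noise A gamma b1 h k i + ((s i)%:R - resp A gamma (betaS b1 h k) i).
Proof.
rewrite {1}/noise big_ord_recr /= -/(noise A gamma b1 (upd h k s) k i).
rewrite (noise_local (upd h k s) h); last by move=> t tk; rewrite upd_lt.
by rewrite upd_eq betaS_upd.
Qed.

(** Increments are conditionally centred, so each step adds only the variance [p (1 - p) <= 1]. *)
Lemma expect_noise_sq k i h :
  expect 0 k (fun h => noise A gamma b1 h k i ^+ 2) h <= k%:R.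
Proof.
elim: k h => [|k IH] h; first by rewrite /= /noise big_ord0 expr0n.
rewrite expectSr add0n -natr1.
apply: (@le_trans _ _ (expect 0 k
    (fun h => 1 * noise A gamma b1 h k i ^+ 2 + 1) h)); last first.
  by rewrite expect_linear expect_cst mul1r lerD2r.
apply: expect_le => {}h; rewrite mul1r /step.
set p := resp A gamma (betaS b1 h k) i; set z := noise A gamma b1 h k i.
rewrite (eq_bigr (fun s : {ffun 'I_n -> bool} =>
    kern h k s * (fun c : bool => (z + (c%:R - p)) ^+ 2) (s i))) => [|s _]; last first.
  by rewrite noise_upd.
rewrite (kern_marginal h k i (fun c : bool => (z + (c%:R - p)) ^+ 2)) -/p.
have /andP[p0 p1] := resp_betaS_itv A_ge0 Aconn Anbip _ _ gamma_gt0 b1_itv h k i.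
rewrite (_ : p * _ + _ = z ^+ 2 + p * (1 - p)) /=; last by ring.
by rewrite -/p in p0 p1; nra.
Qed.

(** Chebyshev's inequality, from the second moment bound. *)
Lemma prob_noise_ge k i (e : R) : 0 < e ->
  measurable [set w | e * k.+1%:R < `|noise A gamma b1 (decl w) k i|] /\
  (P [set w | (e * k.+1%:R < `|noise A gamma b1 (decl w) k i|)%R] <=
    (e ^- 2 / k.+1%:R)%:E)%E.
Proof.
move=> e0; pose B := [set h | e * k.+1%:R < `|noise A gamma b1 h k i|].
have locB : local k B by move=> h h' hh'; rewrite /B /= (noise_local h h').
have k0 : 0 < k.+1%:R :> R by [].
split; first by have [] := prob_local k B locB.
pose C : R := (e * k.+1%:R) ^- 2.
apply: le_trans (prob_le k B (fun h => C * noise A gamma b1 h k i ^+ 2 + 0) locB _) _.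
  move=> h; rewrite addr0 indicE; have C0 : 0 <= C by rewrite invr_ge0 sqr_ge0.
  have [|_] := boolP (h \in B); last by rewrite mulr_ge0 ?sqr_ge0.
  rewrite inE /B /= => /ltW hB; rewrite /C mulrC ler_pdivlMr ?mul1r.
    by rewrite -(real_normK (num_real (noise _ _ _ _ _ _))) ler_sqr ?nnegrE ?mulr_ge0 // ltW.
  by rewrite exprn_gt0 // mulr_gt0.
rewrite expect_linear expect_cst addr0 lee_fin.
apply: (@le_trans _ _ (C * k.+1%:R)).
  rewrite ler_wpM2l ?invr_ge0 ?sqr_ge0 //.
  by apply: le_trans (expect_noise_sq _ _ _) _; rewrite ler_nat.
rewrite /C le_eqVlt; apply/orP; left; apply/eqP; field.
by rewrite !gt_eqF //; apply: ltr_pwDl.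
Qed.

(** Along the squares the Chebyshev bounds are summable, and Borel-Cantelli applies. *)
Lemma noise_squares_ae (e : R) i : 0 < e -> {ae P, forall w,
  \forall j \near \oo, `|noise A gamma b1 (decl w) (j ^ 2)%N i| <= e * (j ^ 2).+1%:R}.
Proof.
move=> e0.
pose F j := [set w | e * (j ^ 2).+1%:R < `|noise A gamma b1 (decl w) (j ^ 2) i|].
have mF j : measurable (F j) by have [] := prob_noise_ge (j ^ 2) i e e0.
have sumF : (\sum_(0 <= j <oo) P (F j) < +oo)%E.
  apply: (@le_lt_trans _ _ (4 * e ^- 2)%:E); last by rewrite ltry.
  apply: lime_le; first exact: is_cvg_nneseries.
  (* [1 / (j^2 + 1) <= 4 / ((j + 1) (j + 2))], whose sum telescopes to at most [4]. *)
  near=> m; have : (\sum_(0 <= j < m) P (F j) <=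
     (4 * e ^- 2 * \sum_(0 <= j < m) (j.+1%:R^-1 - j.+2%:R^-1))%:E)%E.
    rewrite mulr_sumr -sumEFin; apply: lee_sum => j _.
    have [_ PF] := prob_noise_ge (j ^ 2) i e e0; apply: le_trans PF _.
    rewrite lee_fin -mulrA mulrCA; apply: ler_wpM2l; first by rewrite invr_ge0 sqr_ge0.
    have j0 : 0 <= j%:R :> R by [].
    rewrite -[(j ^ 2).+1%:R]natr1 natrX -[j.+1%:R]natr1 -[j.+2]addn2 natrD.
    rewrite (_ : 4 * _ = 4 / ((j%:R + 1) * (j%:R + 2))); last first.
      by field; rewrite !gt_eqF //; lra.
    by rewrite ler_pdivlMr 1?mulrC ?ler_pdivrMr; nra.
  move=> /le_trans; apply; rewrite lee_fin.
  rewrite -[X in _ <= X]mulr1; apply: ler_wpM2l; first by rewrite mulr_ge0 // invr_ge0 sqr_ge0.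
  rewrite -lerN2 -sumrN (eq_bigr (fun j => j.+2%:R^-1 - j.+1%:R^-1)) => [|j _]; last by rewrite opprB.
  rewrite (telescope_sumr (fun j => j.+1%:R^-1)) // invr1 lerBrDr addrC subrr.
  by rewrite invr_ge0.
exists (lim_sup_set F); split.
- apply: bigcapT_measurable => k; exact: bigcup_measurable.
- exact: lim_sup_set_cvg0.
- move=> w /=; rewrite /lim_sup_set => nw k _ /=.
  apply: contrapT => no; apply: nw; near=> j.
  rewrite leNgt; apply/negP => lt; apply: no; exists j => //.
  by near: j; exact: nbhs_infty_ge.
Unshelve. all: by end_near. Qed.

Lemma noise_dist h k l i : (k <= l)%N ->
  `|noise A gamma b1 h l i - noise A gamma b1 h k i| <= (l - k)%:R.
Proof.
move=> /subnKC <-; rewrite addKn; move: (l - k)%N => m.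
elim: m => [|m IH]; first by rewrite addn0 subrr normr0.
rewrite addnS /noise big_ord_recr /= -/(noise A gamma b1 h (k + m) i) addrAC.
rewrite -/(noise A gamma b1 h k i) -natr1; apply: le_trans (ler_normD _ _) _.
apply: lerD => //.
have /andP[p0 p1] := resp_betaS_itv A_ge0 Aconn Anbip _ _ gamma_gt0 b1_itv h (k + m) i.
by rewrite ler_norml; case: (h _ i); rewrite /=; lra.
Qed.

Lemma sqrn_between k : exists j, (j ^ 2 <= k < j.+1 ^ 2)%N.
Proof.
elim: k => [|k [j /andP[jk kj]]]; first by exists 0%N.
have [lt|ge] := ltnP k.+1 (j.+1 ^ 2); first by exists j; rewrite lt leqW.
by exists j.+1; rewrite ge /= (leq_ltn_trans kj) // ltn_sqr.
Qed.

(** Between [j^2] and [(j + 1)^2] the noise moves by at most [2 j], negligible against [j^2]. The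
    tolerances [1 / (l + 1)] keep the exceptional sets countable in number. *)
Lemma quiet_ae : {ae P, forall w, quiet A gamma b1 (decl w)}.
Proof.
have : {ae P, forall w, forall l : nat, forall i, \forall j \near \oo,
    `|noise A gamma b1 (decl w) (j ^ 2)%N i| <= l.+1%:R^-1 * (j ^ 2).+1%:R}.
  apply: ae_foralln => l; apply: filter_forall => i.
  by apply: noise_squares_ae; rewrite invr_gt0.
apply: filterS => w H e e0; apply: filter_forall => i.
have [l le] : exists l : nat, l.+1%:R^-1 <= e / 2.
  exists (Num.truncn (2 / e)); rewrite -[leRHS]invrK lef_pV2 ?posrE ?invr_gt0 ?divr_gt0 //.
  by rewrite invf_div ltW // truncnS_gt.
have [J0 _ hJ0] := H l i.
have [J1 _ hJ1] := near_le_mulSn 4 e e0.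
near=> k.
have [j /andP[jk kj]] := sqrn_between k.
have jJ : (maxn J0 J1.+1 <= j)%N.
  have : ((maxn J0 J1.+1).+1 ^ 2 <= k)%N by near: k; exact: nbhs_infty_ge.
  by move=> /leq_ltn_trans/(_ kj); rewrite ltn_sqr ltnS => /ltnW.
have := hJ0 j (leq_trans (leq_maxl _ _) jJ) => /= Nj.
(* This makes the variation [2 j] at most [e j^2 / 2], half of the allowance. *)
have j4 : 4 <= e * j%:R.
  have := leq_trans (leq_maxr _ _) jJ; by case: j {jk kj jJ Nj} => // j /hJ1.
have := noise_dist (decl w) _ _ i jk => Nkj.
have kj2 : (k - j ^ 2)%:R <= 2 * j%:R :> R.
  rewrite -natrM ler_nat leq_subLR; move: kj.
  by rewrite -[j.+1]addn1 sqrnD muln1 exp1n addnAC addn1 ltnS.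
have jk' : (j ^ 2).+1%:R <= k.+1%:R :> R by rewrite ler_nat.
have jR : j%:R * j%:R <= k%:R :> R by rewrite -natrM ler_nat.
have : `|noise A gamma b1 (decl w) k i| <= (k - j ^ 2)%:R + l.+1%:R^-1 * (j ^ 2).+1%:R.
  rewrite -[X in `|X|](subrK (noise A gamma b1 (decl w) (j ^ 2) i)).
  by apply: le_trans (ler_normD _ _) _; apply: lerD.
move/le_trans; apply.
have : l.+1%:R^-1 * (j ^ 2).+1%:R <= e / 2 * k.+1%:R.
  by apply: ler_pM => //; rewrite invr_ge0.
rewrite -[k.+1%:R]natr1; have j0 : 0 <= j%:R :> R by [].
have : 0 <= (e * j%:R - 4) * j%:R by rewrite mulr_ge0 ?subr_ge0.
have : 0 <= e * (k%:R - j%:R * j%:R) by rewrite mulr_ge0 ?subr_ge0 // ltW.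
move: kj2 e0; set u := (k - _)%:R; set v := _ * (j ^ 2).+1%:R.
move: u v => u v; move: (k%:R : R) (j%:R : R) => x y kj2 e0 h1 h2 h3.
by nra.
Unshelve. all: by end_near. Qed.

Lemma expect_local k l g h : (k <= l)%N ->
  (forall m h s, (k <= m)%N -> g (upd h m s) = g h) ->
  expect 0 l g h = expect 0 k g h.
Proof.
move=> /subnKC <- gloc; elim: (l - k)%N => [|m IH]; first by rewrite addn0.
rewrite addnS expectSr add0n -IH; congr (expect 0 _ _ h); apply/funext => h'.
rewrite /step (eq_bigr (fun s : {ffun 'I_n -> bool} => kern h' (k + m) s * g h')).
  by rewrite -mulr_suml kern_sum mul1r.
by move=> s _; rewrite gloc // leq_addr.
Qed.

(* [b1 i] plus the number of ones among the first [k] declarations of [i]. *)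
Definition succs h k i : R := k.+1%:R * betaS b1 h k i.

Lemma succs_gt0 h k i : 0 < succs h k i.
Proof. by rewrite mulr_gt0 // betaS_gt0. Qed.

Lemma succs_upd h k s i : succs (upd h k s) k.+1 i = succs h k i + (s i)%:R.
Proof.
rewrite /succs !betaS_sum big_ord_recr /= upd_eq addrA; congr (_ + _ + _).
by apply: eq_bigr => t _; rewrite upd_lt.
Qed.

Lemma succs_le h k l i : (k <= l)%N -> succs h k i <= succs h l i.
Proof.
move=> /subnKC <-; elim: (l - k)%N => [|m IH]; first by rewrite addn0.
apply: le_trans IH _; rewrite addnS /succs !betaS_sum big_ord_recr /= addrA lerDl.
by case: (h _ i).
Qed.

(** A count [S] grows by one with probability [p], and [p / (S + 1) + (1 - p) / S = (1 - p / (S +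
    1)) / S]. *)
Lemma step_inv_succs h k (c : 'I_n -> R) :
  step k (fun h => \sum_i c i / succs h k.+1 i) h =
  \sum_i c i / succs h k i *
    (1 - resp A gamma (betaS b1 h k) i / (succs h k i + 1)).
Proof.
rewrite /step; under eq_bigr do rewrite mulr_sumr.
rewrite exchange_big; apply: eq_bigr => i _ /=.
have S0 := succs_gt0 h k i; set S := succs h k i in S0 *.
rewrite (eq_bigr (fun s : {ffun 'I_n -> bool} =>
    kern h k s * (fun a : bool => c i / (S + a%:R)) (s i))) => [|s _]; last first.
  by rewrite succs_upd.
rewrite (kern_marginal h k i (fun a : bool => c i / (S + a%:R))) /= addr0.
by field; rewrite !gt_eqF //; lra.
Qed.

(** * Repulsion from the corner 0 in the supercritical case *)

Section Repulsion.
Variables (w : 'I_n -> R) (rho : R).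
Hypothesis w_gt0 : forall i, 0 < w i.
Hypothesis w_eig : forall i, gamma i * mu A w i = rho * w i.
Hypothesis rho_gt1 : 1 < rho.

Let dgt0 := deg_gt0 A_ge0 Aconn Anbip.

(** The initial values alone keep each coordinate above a constant over [k + 1]; by divergence of
    the harmonic series this is enough to force many ones. *)
Lemma resp_lower : exists2 c : R, 0 < c &
  forall h k i, c / k.+1%:R <= resp A gamma (betaS b1 h k) i.
Proof.
have [kappa [delta [k0 k1 kr /andP[d0 d1] flin]]] :=
  linear_response gamma gamma_gt0 w rho w_gt0 w_eig rho_gt1.
have [m m0 mb] := pos_lower_bound b1 (fun i => proj1 (andP (b1_itv i))).
have [gm gm0 gmg] := pos_lower_bound gamma gamma_gt0.
pose x := Num.min m delta; have x0 : 0 < x by rewrite lt_min m0.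
have [xm xd] : x <= m /\ x <= delta by rewrite !ge_min !lexx orbT.
exists (kappa * (gm * x)); first by rewrite !mulr_gt0.
move=> h k i; have kR : 0 < k.+1%:R :> R by [].
have xk : x / k.+1%:R <= x by rewrite ler_pdivrMr // ler_peMr ?ler1n ?(ltW x0).
apply: (@le_trans _ _ (f (x / k.+1%:R) (gamma i))); last first.
  apply: f_le => //; first by rewrite divr_ge0 ?ltW.
    rewrite -(mu_cst A_ge0 Aconn Anbip (x / k.+1%:R) i).
    apply: (mu_le A_ge0 Aconn Anbip) => j; apply: le_trans (betaS_ge b1 h k j).
    by rewrite ler_pM2r ?invr_gt0 //; apply: le_trans xm _.
  by have /andP[] := mu_itv A_ge0 Aconn Anbip _ i (betaS_itv b1 b1_itv h k).
apply: le_trans (flin (x / k.+1%:R) i _ _); last exact: le_trans xk xd.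
  rewrite -!mulrA ler_pM2l // ler_pM2r ?divr_gt0 //.
by rewrite divr_ge0 ?ltW.
Qed.

(** At step [k] the expected sum of inverse counts drops by at least [c1 / (k + 1)] times the
    probability that some count is below [K]. If that probability always exceeded [eta],
    [harmonic_descent] would give a contradiction. *)
Lemma few_succs (K eta : R) : 0 < K -> 0 < eta -> exists m,
  expect 0 m \1_[set h | exists i, succs h m i < K] (fun _ _ => false) <= eta.
Proof.
move=> K0 eta0; have [c c0 resp_ge] := resp_lower; apply: contrapT => /forallNP no.
pose c1 := c / (K * (K + 1)).
have c10 : 0 < c1 by rewrite divr_gt0 // mulr_gt0 // addr_gt0.
pose g k h : R := \sum_i 1 / succs h k i.
pose e k := expect 0 k (g k) (fun _ _ => false).
apply: (harmonic_descent e (c1 * eta) 0); first by rewrite mulr_gt0.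
  move=> k _; rewrite -[0](congr1 (@^~ (fun _ _ => false)) (expect_cst 0 k 0)).
  by apply: expect_le => h; apply: sumr_ge0 => i _; rewrite divr_ge0 // ltW // succs_gt0.
move=> k _; have k0 : 0 < k.+1%:R :> R by [].
have := no k => /negP; rewrite -ltNge.
set q := expect 0 k _ _ => qk.
apply: (@le_trans _ _ (- (c1 / k.+1%:R) * q + e k)); last first.
  rewrite addrC lerD2l mulNr lerN2 mulrAC.
  by rewrite ler_pM2l ?(divr_gt0 c10 k0) // ltW.
rewrite /e /q expectSr add0n -[leRHS](congr1 (@^~ (fun _ _ => false))
  (expect_linear 0 k _ _ _)); apply: expect_le => h.
rewrite /g step_inv_succs.
have term_ge0 i : 0 <= 1 / succs h k i *
    (resp A gamma (betaS b1 h k) i / (succs h k i + 1)).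
  have S0 := succs_gt0 h k i.
  have /andP[p0 _] := resp_betaS_itv A_ge0 Aconn Anbip _ _ gamma_gt0 b1_itv h k i.
  by apply: mulr_ge0; apply: divr_ge0; rewrite ?addr_ge0 ?(ltW S0).
under eq_bigr do rewrite mulrBr mulr1.
rewrite sumrB addrC lerD2r mulNr lerN2 indicE.
have [|_] := boolP (h \in _); last by rewrite mulr0 sumr_ge0.
rewrite inE mulr1 => -[i SK]; rewrite (bigD1 i) //=.
apply: ler_wpDr; first exact: sumr_ge0.
have S0 := succs_gt0 h k i; rewrite /c1 div1r mulrCA -invfM mulrAC.
apply: ler_pM; rewrite ?invr_ge0 ?divr_ge0 ?mulr_ge0 ?addr_ge0 ?(ltW K0) ?(ltW c0) //.
have K10 : 0 < K + 1 by rewrite addr_gt0.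
have S10 : 0 < succs h k i + 1 by rewrite addr_gt0.
rewrite lef_pV2 ?posrE; [|exact: mulr_gt0|exact: mulr_gt0].
by apply: ler_pM; rewrite ?lerD2r; exact: ltW.
Qed.

(** With [z = y / w], [cw i / y i] is the weight [w_i^2 deg_i / gamma_i] divided by [z_i]; [rho]
    times that weight is the [i]-th row sum of the symmetric matrix [A_ij w_i w_j]. *)
Let cw i := w i ^+ 3 * (deg A i / gamma i).

Let cw_gt0 i : 0 < cw i.
Proof. by rewrite mulr_gt0 ?exprn_gt0 // divr_gt0. Qed.

(* Tangent-line bound [z_j / z_i ^ 2 >= 2 / z_i - 1 / z_j] for [z = y / w],
   summed against the symmetric weights [A i j * w i * w j]. *)
Lemma convex_eig (y : 'I_n -> R) : (forall i, 0 < y i) ->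
  rho * \sum_i cw i / y i <= \sum_i cw i / y i * (gamma i * mu A y i / y i).
Proof.
move=> y0; have w_eigA i : \sum_j A i j * w j = rho * (deg A i / gamma i * w i).
  rewrite -(muE A_ge0 Aconn Anbip) [RHS]mulrCA -w_eig.
  by field; rewrite gt_eqF.
pose a i := w i ^+ 2 / y i.
have aE : \sum_i a i * \sum_j A i j * w j = rho * \sum_i cw i / y i.
  rewrite mulr_sumr; apply: eq_bigr => i _; rewrite w_eigA /a /cw.
  by field; rewrite !gt_eqF.
have aE' : \sum_i \sum_j A i j * w i * a j = rho * \sum_i cw i / y i.
  rewrite -aE exchange_big; apply: eq_bigr => j _; rewrite mulr_sumr.
  by apply: eq_bigr => i _; rewrite (adj_sym Asym i j); ring.
have : \sum_i \sum_j (2 * (a i * (A i j * w j)) - A i j * w i * a j) <=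
    \sum_i \sum_j A i j * (w i ^+ 3 * y j / y i ^+ 2).
  apply: ler_sum => i _; apply: ler_sum => j _; rewrite -subr_ge0.
  rewrite (_ : _ - _ = A i j * (w i * (w i * y j - w j * y i) ^+ 2 / (y i ^+ 2 * y j))).
    have y2 : 0 < y i ^+ 2 by rewrite exprn_gt0.
    by rewrite mulr_ge0 // divr_ge0 // mulr_ge0 ?sqr_ge0 // ltW.
  by rewrite /a; field; rewrite !gt_eqF.
have -> : \sum_i \sum_j A i j * (w i ^+ 3 * y j / y i ^+ 2) =
    \sum_i cw i / y i * (gamma i * mu A y i / y i).
  apply: eq_bigr => i _; transitivity (w i ^+ 3 / y i ^+ 2 * \sum_j A i j * y j).
    by rewrite mulr_sumr; apply: eq_bigr => j _; ring.
  by rewrite -(muE A_ge0 Aconn Anbip) /cw; field; rewrite !gt_eqF.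
apply: le_trans.
rewrite [leRHS](_ : _ = 2 * (\sum_i a i * \sum_j A i j * w j) -
    \sum_i \sum_j A i j * w i * a j); first by rewrite aE aE'; lra.
rewrite mulr_sumr -sumrB; apply: eq_bigr => i _.
by rewrite !mulr_sumr -sumrB.
Qed.


Let drift_cst delta := \sum_i cw i * (1 + gamma i) / delta.

(** Truncating [b] to [y = min(b, delta)] makes the linear minorant available, and [convex_eig] is
    applied to [y]. A coordinate above [delta] costs at most [cw i (1 + gamma i) / delta], collected
    in [drift_cst]. The factor [theta] allows for a count [S] being replaced by [S + 1]. *)
Lemma drift_le (kappa delta theta : R) (b : 'I_n -> R) :
  0 < kappa <= 1 -> 0 < theta <= 1 -> 1 <= theta * kappa * rho ->
  0 < delta <= 1 ->
  (forall x i, 0 <= x -> x <= delta -> kappa * (gamma i * x) <= f x (gamma i)) ->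
  (forall i, 0 < b i <= 1) ->
  \sum_i cw i / b i * (1 - theta * (resp A gamma b i / b i)) <=
  (1 - theta * kappa * rho) * (\sum_i cw i / b i) + drift_cst delta.
Proof.
move=> /andP[k0 k1] /andP[t0 t1] tkr /andP[d0 d1] flin b01.
pose y i := Num.min (b i) delta.
have b0 i : 0 < b i by case/andP: (b01 i).
have y0 i : 0 < y i by rewrite lt_min b0.
have yb i : y i <= b i by rewrite ge_min lexx.
have yd i : y i <= delta by rewrite ge_min lexx orbT.
have my_ge0 i : 0 <= mu A y i.
  rewrite -(mu_cst A_ge0 Aconn Anbip 0 i); apply: (mu_le A_ge0 Aconn Anbip) => j.
  exact: ltW.
have my_led i : mu A y i <= delta.
  by rewrite -(mu_cst A_ge0 Aconn Anbip delta i); apply: (mu_le A_ge0 Aconn Anbip).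
have resp_ge i : kappa * (gamma i * mu A y i) <= resp A gamma b i.
  apply: le_trans (flin _ i (my_ge0 i) (my_led i)) _; apply: f_le => //.
    exact: (mu_le A_ge0 Aconn Anbip).
  rewrite -(mu_cst A_ge0 Aconn Anbip 1 i); apply: (mu_le A_ge0 Aconn Anbip) => j.
  by case/andP: (b01 j).
pose r i := theta * kappa * (gamma i * mu A y i).
have r_ge0 i : 0 <= r i by apply: mulr_ge0; apply: mulr_ge0 => //; exact: ltW.
have r_le i : r i <= theta * resp A gamma b i.
  by rewrite /r -mulrA ler_pM2l.
have inv_le i : (b i)^-1 <= (y i)^-1 by rewrite lef_pV2 ?posrE.
have term i : cw i / b i * (1 - theta * (resp A gamma b i / b i)) <=
    cw i / y i * (1 - r i / y i) + cw i * (1 + gamma i) / delta.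
  rewrite -!(mulrA (cw i)) -mulrDr ler_pM2l //.
  apply: (@le_trans _ _ ((b i)^-1 * (1 - r i / b i))).
    rewrite ler_pM2l ?invr_gt0 // lerD2l lerN2 mulrA ler_pM2r ?invr_gt0 //.
  have gd0 : 0 <= (1 + gamma i) / delta by rewrite divr_ge0 ?addr_ge0 ?ltW.
  have [bd|db] := leP (b i) delta.
    by rewrite /y min_l // lerDl.
  have yE : y i = delta by rewrite /y min_r // ltW.
  rewrite yE; apply: (@le_trans _ _ delta^-1).
    rewrite -yE -[leRHS]mulr1; apply: (@le_trans _ _ ((b i)^-1 * 1)).
      by rewrite ler_pM2l ?invr_gt0 // lerBlDr lerDl divr_ge0 // ltW.
    by rewrite !mulr1.
  have rd : r i / delta <= gamma i.
    rewrite ler_pdivrMr // /r; have g0 := gamma_gt0 i.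
    have tk1 : theta * kappa <= 1 by rewrite mulr_ile1 // ltW.
    apply: (@le_trans _ _ (gamma i * mu A y i)).
      by rewrite ler_piMl // mulr_ge0 // ltW.
    by rewrite ler_pM2l.
  rewrite mulrC -mulrDl ler_peMl ?invr_ge0 ?ltW //; lra.
apply: le_trans (ler_sum _ (fun i _ => term i)) _.
rewrite big_split /= lerD2r.
have tang := convex_eig y y0.
have -> : \sum_i cw i / y i * (1 - r i / y i) = \sum_i cw i / y i -
    theta * kappa * \sum_i cw i / y i * (gamma i * mu A y i / y i).
  rewrite mulr_sumr -sumrB; apply: eq_bigr => i _; rewrite /r; ring.
apply: (@le_trans _ _ ((1 - theta * kappa * rho) * \sum_i cw i / y i)).
  rewrite mulrBl mul1r lerD2l lerN2 -[leLHS]mulrA.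
  by apply: ler_wpM2l => //; rewrite ltW // mulr_gt0.
(* [1 - theta kappa rho] is nonpositive, and truncation only increases the potential. *)
apply: ler_wnM2l; first by rewrite subr_le0.
apply: ler_sum => i _.
by rewrite ler_pM2l.
Qed.

Let Phi k h := \sum_i cw i / betaS b1 h k i.

(** As [1 / beta = (k + 1) / S], the passage to [k + 2] adds [Phi / (k + 1)], while the increments
    of [S] subtract. Counts of at least [K] give [1 / (S + 1) >= theta / S], which reduces the
    balance to [drift_le]. *)
Lemma step_Phi (kappa delta K theta : R) k h :
  0 < kappa <= 1 -> 0 < delta <= 1 ->
  (forall x i, 0 <= x -> x <= delta -> kappa * (gamma i * x) <= f x (gamma i)) ->
  0 < K -> theta = K / (K + 1) -> 1 <= theta * kappa * rho ->
  (forall i, K <= succs h k i) ->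
  step k (Phi k.+1) h <=
  Phi k h + (drift_cst delta - (theta * kappa * rho - 1) * Phi k h) / k.+1%:R.
Proof.
move=> k01 d01 flin K0 thetaE tkr KS; have K10 : 0 < K + 1 by rewrite addr_gt0.
have t01 : 0 < theta <= 1 by rewrite thetaE divr_gt0 //= ler_pdivrMr // mul1r lerDl.
have k0 : 0 < k.+1%:R :> R by [].
have -> : Phi k.+1 = (fun h => \sum_i (cw i * k.+2%:R) / succs h k.+1 i).
  apply/funext => h'; apply: eq_bigr => i _; rewrite /succs.
  have b0 := betaS_gt0 b1 b1_itv h' k.+1 i; have k20 : 0 < k.+2%:R :> R by [].
  by field; rewrite !gt_eqF //; lra.
rewrite step_inv_succs.
have b01 i : 0 < betaS b1 h k i <= 1 by rewrite betaS_gt0 ?ltW ?betaS_lt1.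
have := drift_le kappa delta theta _ k01 t01 tkr d01 flin b01.
rewrite -/(Phi k h) => drift.
apply: (@le_trans _ _ (Phi k h + (\sum_i cw i / betaS b1 h k i *
    (1 - theta * (resp A gamma (betaS b1 h k) i / betaS b1 h k i))) / k.+1%:R)); last first.
  by rewrite lerD2l ler_pM2r ?invr_gt0 //; lra.
rewrite /Phi mulr_suml -big_split; apply: ler_sum => i _ /=.
have b0 := betaS_gt0 b1 b1_itv h k i.
have /andP[p0 p1] := resp_betaS_itv A_ge0 Aconn Anbip _ _ gamma_gt0 b1_itv h k i.
have S0 := succs_gt0 h k i; have := KS i.
have -> : betaS b1 h k i = succs h k i / k.+1%:R.
  by rewrite /succs mulrAC mulfV ?mul1r // gt_eqF.
move: (succs h k i) S0 (resp A gamma _ i) p0 => S S0 p p0 {}KS.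
have S10 : 0 < S + 1 by rewrite addr_gt0.
pose u := p / (S + 1); pose v := theta * (p / S).
have u0 : 0 <= u by rewrite divr_ge0 // ltW.
have vu : v <= u.
  rewrite /v /u mulrCA ler_wpM2l // ler_pdivrMr // mulrC ler_pdivlMr //.
  rewrite thetaE mulrAC ler_pdivrMr //; nra.
rewrite -/u; set t := k.+1%:R in k0 *.
have -> : k.+2%:R = t + 1 :> R by rewrite natr1.
rewrite [leRHS](_ : _ = cw i / S * (t + 1 - t * v)); last first.
  by rewrite /v; field; rewrite !gt_eqF.
rewrite [leLHS](_ : _ = cw i / S * ((t + 1) * (1 - u))); last by ring.
rewrite ler_pM2l ?divr_gt0 //.
have : t * v <= t * u by rewrite ler_pM2l.
by lra.
Qed.

(** [eps] is chosen before [M], so one box serves arbitrarily late times. On histories whose counts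
    at [m] reach [K], the expected potential obeys [e (k+1) <= e k - (c e k - C) / (k + 1)]. Thus
    [c e k <= C + 1] infinitely often, and Markov's inequality concludes. *)
Lemma rarely_small (eta eps1 : R) : 0 < eta -> 0 < eps1 ->
  exists2 eps, 0 < eps <= eps1 & forall M, exists2 k, (M <= k)%N &
    measurable [set z | exists i, betaS b1 (decl z) k i < eps * w i] /\
    (P [set z | exists i, (betaS b1 (decl z) k i < eps * w i)%R] <= eta%:E)%E.
Proof.
move=> eta0 eps10.
have [kappa [delta [k0 k1 kr d01 flin]]] :=
  linear_response gamma gamma_gt0 w rho w_gt0 w_eig rho_gt1.
have k01 : 0 < kappa <= 1 by rewrite k0 ltW.
have kr1 : 0 < kappa * rho - 1 by rewrite subr_gt0.
(* With this [K], [theta kappa rho - 1] equals [1 / (K + 1)], hence is positive. *)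
pose K := 2 / (kappa * rho - 1); pose theta := K / (K + 1).
have K0 : 0 < K by rewrite divr_gt0.
have K10 : 0 < K + 1 by rewrite addr_gt0.
pose c := theta * kappa * rho - 1.
have cE : c = (K + 1)^-1.
  have e : K * (kappa * rho) = K + 2 by rewrite /K; field; rewrite gt_eqF.
  rewrite /c /theta (_ : K / (K + 1) * kappa * rho = K * (kappa * rho) / (K + 1)); last by ring.
  by rewrite e; field; rewrite gt_eqF.
have c0 : 0 < c by rewrite cE invr_gt0.
pose C := drift_cst delta.
have C0 : 0 <= C.
  case/andP: d01 => d0 _; apply: sumr_ge0 => i _.
  apply: divr_ge0; last exact: ltW.
  by apply: mulr_ge0; [exact: ltW|rewrite addr_ge0 // ltW].
have [cm cm0 cmle] := pos_lower_bound (fun i => cw i / w i) (fun i => divr_gt0 (cw_gt0 i) (w_gt0 i)).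
have [m few] := few_succs K (eta / 2) K0 (divr_gt0 eta0 (ltr0Sn _ _)).
set Few := [set h | _] in few.
have Few_upd k h s : (m <= k)%N -> Few (upd h k s) = Few h.
  by move=> mk; rewrite /Few /= /succs betaS_upd.
(* The indicator of the complement of [Few] is settled by time [m], so it factors out of every later
   [step]. *)
pose G h : R := 1 - \1_Few h.
have indic_upd k h s : (m <= k)%N -> \1_Few (upd h k s) = \1_Few h :> R.
  by move=> mk; rewrite !indicE; congr ((_ : bool)%:R); apply/idP/idP; rewrite !inE Few_upd.
have G01 h : 0 <= G h <= 1 by rewrite /G indicE; case: (_ \in _); rewrite ?subrr ?subr0 lexx ler01.
have Phi_ge0 k h : 0 <= Phi k h.
  by apply: sumr_ge0 => i _; rewrite divr_ge0 ?ltW ?betaS_gt0.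
pose h0 : nat -> 'I_n -> bool := fun _ _ => false.
pose e k := expect 0 k (fun h => G h * Phi k h) h0.
have e_ge0 k : 0 <= e k.
  rewrite -[0](congr1 (@^~ h0) (expect_cst 0 k 0)); apply: expect_le => h.
  by rewrite mulr_ge0 //; case/andP: (G01 h).
have e_rec k : (m <= k)%N -> e k.+1 <= e k - (c * e k - C) / k.+1%:R.
  move=> mk; have k10 : 0 < k.+1%:R :> R by [].
  rewrite (_ : _ - _ = (1 - c / k.+1%:R) * e k + C / k.+1%:R); last by ring.
  rewrite -[C / _](congr1 (@^~ h0) (expect_cst 0 k (C / k.+1%:R))) /e.
  rewrite -[leRHS](congr1 (@^~ h0) (expect_linear 0 k _ _ _)) expectSr add0n.
  apply: expect_le => h.
  have -> : step k (fun h => G h * Phi k.+1 h) h = G h * step k (Phi k.+1) h.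
    rewrite /step mulr_sumr; apply: eq_bigr => s _.
    by rewrite /G indic_upd //; ring.
  rewrite /G indicE; have [_|] := boolP (h \in Few).
    by rewrite subrr !mul0r mulr0 add0r divr_ge0 // ltW.
  rewrite notin_setE => notfew; rewrite subr0 !mul1r.
  have KS i : K <= succs h k i.
    apply: le_trans (succs_le h m k i mk); rewrite leNgt; apply/negP => SK.
    by apply: notfew; exists i.
  have tkr : 1 <= theta * kappa * rho by rewrite -subr_ge0 ltW.
  apply: le_trans (step_Phi kappa delta K theta k h k01 d01 flin K0 erefl tkr KS) _.
  rewrite -/c -/C le_eqVlt; apply/orP; left; apply/eqP; ring.
have C10 : 0 < C + 1 by rewrite ltr_wpDl.
(* When [c e k <= C + 1], the second bound makes Markov's inequality give [eta / 2]; the other half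
   of [eta] pays for [Few]. *)
exists (Num.min eps1 (eta * c * cm / (2 * (C + 1)))).
  by rewrite lt_min eps10 ge_min lexx andbT divr_gt0 // !mulr_gt0.
set eps := Num.min _ _ => M.
have eps0 : 0 < eps by rewrite lt_min eps10 divr_gt0 // !mulr_gt0.
have [k Mk ek] : exists2 k, (maxn m M <= k)%N & c * e k <= C + 1.
  apply: contrapT => no; apply: (harmonic_descent e 1 (maxn m M)) => // k mMk.
  have mk : (m <= k)%N := leq_trans (leq_maxl _ _) mMk.
  apply: le_trans (e_rec k mk) _; rewrite lerD2l lerN2 ler_pM2r ?invr_gt0 //.
  rewrite lerBrDr addrC leNgt; apply/negP => lt; apply: no; exists k => //.
  exact: ltW.
have mk : (m <= k)%N := leq_trans (leq_maxl _ _) Mk.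
exists k; first exact: leq_trans (leq_maxr _ _) Mk.
pose B := [set h | exists i, betaS b1 h k i < eps * w i].
have locB : local k B by move=> h h' hh'; rewrite /B /= (betaS_local h h').
split; first by have [] := prob_local k B locB.
have B_le h : \1_B h <= eps / cm * (G h * Phi k h) + \1_Few h.
  have ec0 : 0 < eps / cm by rewrite divr_gt0.
  rewrite /G [\1_Few h]indicE; have [_|_] := boolP (h \in Few).
    by rewrite subrr mul0r mulr0 add0r indicE lern1 leq_b1.
  rewrite subr0 mul1r addr0 indicE.
  have [|_] := boolP (h \in B); last by rewrite mulr_ge0 // ltW.
  rewrite inE => -[i bi]; rewrite mulrC -ler_pdivrMr // div1r invf_div.
  apply: (@le_trans _ _ (cw i / betaS b1 h k i)); last first.
    rewrite /Phi (bigD1 i) //= lerDl; apply: sumr_ge0 => j _.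
    by rewrite divr_ge0 ?ltW ?betaS_gt0.
  have b0 := betaS_gt0 b1 b1_itv h k i.
  rewrite ler_pdivrMr // mulrAC ler_pdivlMr //.
  have := cmle i; rewrite ler_pdivlMr // => cmw.
  apply: le_trans (ler_wpM2r (ltW eps0) cmw).
  by rewrite -mulrA ler_pM2l // [leRHS]mulrC ltW.
apply: le_trans (prob_le k B _ locB B_le) _; rewrite lee_fin.
rewrite [leLHS](congr1 (@^~ h0) (expect_linear 0 k _ _ _)) -/(e k).
rewrite (expect_local m k \1_Few h0 mk) => [|l h s]; last exact: indic_upd.
have : eps / cm * e k <= eta / 2.
  apply: (@le_trans _ _ (eta * c / (2 * (C + 1)) * e k)).
    rewrite ler_wpM2r // ler_pdivrMr // mulrAC.
    by rewrite ge_min lexx orbT.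
  rewrite (_ : _ * e k = eta / 2 * (c * e k / (C + 1))); last by field; rewrite gt_eqF.
  by rewrite ler_piMr ?divr_ge0 ?(ltW eta0) // ler_pdivrMr // mul1r.
by rewrite -/h0 in few *; lra.
Qed.

(** A quiet path that is in the box [beta >= eps w] at some late enough time stays away from [0].
    The other quiet paths miss the box from some time on: they lie in an increasing union of events
    [D M], each of probability at most [eta], and [eta] is arbitrary. *)
Lemma repelled_ae : {ae P, forall z, exists2 c : R, 0 < c &
  \forall k \near \oo, forall i, c <= betaS b1 (decl z) k i}.
Proof.
pose good z := exists2 c : R, 0 < c &
  \forall k \near \oo, forall i, c <= betaS b1 (decl z) k i.
suff : P.-negligible [set z | quiet A gamma b1 (decl z) /\ ~ good z].
  move=> neg; have : {ae P, forall z, ~ (quiet A gamma b1 (decl z) /\ ~ good z)}.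
    by apply: negligibleS neg => z /= /contrapT.
  move=> nq; near=> z; apply: contrapT => ngood.
  have : ~ (quiet A gamma b1 (decl z) /\ ~ good z) by near: z; exact: nq.
  by apply; split=> //; near: z; exact: quiet_ae.
have [eps0 [sigma [eps00 sigma0 persist]]] :=
  quiet_persist A_ge0 Aconn Anbip gamma b1 gamma_gt0 b1_itv w rho w_gt0 w_eig rho_gt1.
apply: negligible_of_small => eta eta0.
have [eps /andP[e0 ele] small] := rarely_small eta eps0 eta0 eps00.
pose E k := [set z | exists i, betaS b1 (decl z) k i < eps * w i].
have mE k : measurable (E k).
  have [] // := prob_local k [set h | exists i, betaS b1 h k i < eps * w i].
  by move=> h h' hh' /=; rewrite (betaS_local h h').
pose D M := \bigcap_(k in [set k | (M <= k)%N]) E k.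
have mD M : measurable (D M) by apply: bigcap_measurableType => k _.
have PD M : (P (D M) <= eta%:E)%E.
  have [k Mk [_ Pk]] := small M; apply: le_trans Pk.
  by apply: le_measure; rewrite ?inE //; [exact: mE|move=> z; exact].
exists (\bigcup_M D M); split.
- exact: bigcup_measurable.
- have cvgD : (P \o D) M @[M --> \oo] --> P (\bigcup_M D M).
    apply: nondecreasing_cvg_mu => //; first exact: bigcup_measurable.
    move=> M N MN; apply/subsetPset => z Dz k /= Nk; apply: Dz.
    exact: leq_trans Nk.
  rewrite [leLHS](_ : _ = limn (P \o D)); last by apply/esym/cvg_lim.
  apply: lime_le; first by apply/cvg_ex; eexists; exact: cvgD.
  by near=> M; exact: PD.
- move=> z /= [qz ngood]; apply: contrapT => nD; apply: ngood.
  have [K0 _ hK0] := persist eps (decl z) e0 ele qz.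
  have [K K0K hK] : exists2 K, (K0 <= K)%N & forall i, eps * w i <= betaS b1 (decl z) K i.
    apply: contrapT => no; apply: nD; exists K0 => // k /= K0k.
    apply: contrapT => nE; apply: no; exists k => // i.
    by rewrite leNgt; apply/negP => lt; apply: nE; exists i.
  have [m m0 mw] := pos_lower_bound w w_gt0.
  exists (sigma * eps * m); first by rewrite !mulr_gt0.
  exists K => // k /= Kk i; apply: le_trans (hK0 K K0K hK k i Kk).
  by rewrite ler_pM2l // mulr_gt0.
Unshelve. all: by end_near. Qed.

End Repulsion.

Lemma measurable_cvg (x : 'I_n -> R) : measurable
  [set z | forall i, (fun k => betaS b1 (decl z) k i) @ \oo --> x i].
Proof.
rewrite (_ : [set z | _] = \bigcap_(i in [set: 'I_n]) \bigcap_l \bigcup_K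
    \bigcap_(k in [set k | (K <= k)%N])
    [set z | `|x i - betaS b1 (decl z) k i| <= l.+1%:R^-1]).
  apply: fin_bigcap_measurable => [|i _]; first exact: finite_finset.
  apply: bigcapT_measurable => l; apply: bigcup_measurable => K _.
  apply: bigcap_measurableType => k _.
  have [] // := prob_local k [set h | `|x i - betaS b1 h k i| <= l.+1%:R^-1].
  by move=> h h' hh' /=; rewrite (betaS_local h h').
apply/seteqP; split=> z /=.
  move=> cz i _ l _; have /cvgrPdist_le/(_ l.+1%:R^-1) := cz i.
  by rewrite invr_gt0 => /(_ (ltr0Sn _ _))[K _ hK]; exists K.
move=> cz i; apply/cvgrPdist_le => e e0.
have [l le] : exists l : nat, l.+1%:R^-1 <= e.
  exists (Num.truncn e^-1); rewrite -[leRHS]invrK lef_pV2 ?posrE ?invr_gt0 //.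
  by rewrite ltW // truncnS_gt.
have [K _ hK] := cz i I l I; exists K => // k /= Kk.
by apply: le_trans le; apply: hK.
Qed.

End Link.
End Expectation.

(** * Convergence to a corner *)

Section Flip.
Context {R : realType} {n : nat} {A : 'M[R]_n}.
Hypothesis A_ge0 : forall i j, 0 <= A i j.
Hypothesis Aconn : graph_connected A.
Hypothesis Anbip : ~ graph_bipartite A.
Variables gamma b1 : 'I_n -> R.
Hypothesis gamma_gt0 : forall i, 0 < gamma i.
Hypothesis b1_itv : forall i, 0 < b1 i < 1.

Let negh (h : nat -> 'I_n -> bool) t i := ~~ h t i.

Lemma betaS_flip h k :
  betaS (fun i => 1 - b1 i) (negh h) k = (fun i => 1 - betaS b1 h k i).
Proof.
elim: k => [//|k IH]; apply/funext => i /=; rewrite IH.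
have k0 : 0 <= k%:R :> R by [].
rewrite /negh -[k.+2]addn2 -[k.+1]addn1 !natrD.
by case: (h _ i) => /=; field; rewrite !gt_eqF //; lra.
Qed.

Lemma kern_flip h m s :
  kern (A := A) (fun i => (gamma i)^-1) (fun i => 1 - b1 i) (negh h) m (fun i => ~~ s i) =
  kern (A := A) gamma b1 h m s.
Proof.
apply: eq_bigr => i _; rewrite betaS_flip /resp.
rewrite (mu_flip A_ge0 Aconn Anbip) f_flip //; last first.
  exact: (mu_itv A_ge0 Aconn Anbip _ _ (betaS_itv b1 b1_itv h m)).
by rewrite /bern; case: (s i) => //=; ring.
Qed.

Lemma hist_event_flip (T : Type) (psi : nat -> 'I_n -> T -> bool) m h :
  hist_event (fun t i z => ~~ psi t i z) m h = hist_event psi m (negh h).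
Proof.
apply/seteqP; split=> z /= H k km i; have := H k km i.
  by rewrite /negh => <-; rewrite negbK.
by move=> ->; rewrite /negh negbK.
Qed.

Lemma law_flip {d} {T : measurableType d} (P : probability T R)
    (psi : nat -> 'I_n -> T -> bool) :
  (forall m h (s : 'I_n -> bool),
    P (hist_event psi m h `&` [set w | forall i, psi m.+2 i w = s i])
    = (P (hist_event psi m h) * (kern (A := A) gamma b1 h m s)%:E)%E) ->
  forall m h (s : 'I_n -> bool),
    P (hist_event (fun t i z => ~~ psi t i z) m h `&`
       [set w | forall i, ~~ psi m.+2 i w = s i])
    = (P (hist_event (fun t i z => ~~ psi t i z) m h) *
      (kern (A := A) (fun i => (gamma i)^-1) (fun i => 1 - b1 i) h m s)%:E)%E.
Proof.
move=> law m h s; rewrite hist_event_flip.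
rewrite [X in _ `&` X](_ : _ = [set w | forall i, psi m.+2 i w = ~~ s i]).
  rewrite law -(kern_flip (negh h)) /negh.
  congr (_ * (kern _ _ _ _ _)%:E)%E; last by apply/funext => i; rewrite negbK.
  by apply/funext => t; apply/funext => i; rewrite negbK.
by apply/seteqP; split=> z /= H i; [rewrite -H negbK|rewrite H negbK].
Qed.

End Flip.

(** * Almost sure behaviour at the corner 0 *)

Section AtZero.
Context {R : realType} {n : nat} {A : 'M[R]_n}.
Hypothesis Asym : A^T = A.
Hypothesis A_ge0 : forall i j, 0 <= A i j.
Hypothesis Aconn : graph_connected A.
Hypothesis Anbip : ~ graph_bipartite A.
Variables gamma b1 : 'I_n -> R.
Hypothesis gamma_gt0 : forall i, 0 < gamma i.
Hypothesis gamma_neq1 : exists i, gamma i != 1.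
Hypothesis b1_itv : forall i, 0 < b1 i < 1.
Context {d : measure_display} {T : measurableType d} {P : probability T R}.
Variable psi : nat -> 'I_n -> T -> bool.
Hypothesis psi_meas : forall t i, measurable [set w | psi t i w].
Hypothesis psi_law : forall m h (s : 'I_n -> bool),
  P (hist_event psi m h `&` [set w | forall i, psi m.+2 i w = s i])
  = (P (hist_event psi m h) * (kern (A := A) gamma b1 h m s)%:E)%E.

(** Stated for a general [g] to cover both corners, as [J0] at the inverse biases is [J1]. *)
Lemma perron_J0 (g : 'I_n -> R) : (forall i, 0 < g i) ->
  exists2 w : 'I_n -> R, (forall i, 0 < w i) &
    forall i, g i * mu A w i = lambda_max (J0 A g) * w i.
Proof.
move=> g0; have [i0 _] := gamma_neq1.
have dgt0 := deg_gt0 A_ge0 Aconn Anbip.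
have [|rho [w [w0 eig]]] := perron Asym A_ge0 Aconn i0 (fun i => deg A i / g i).
  by move=> i; rewrite divr_gt0.
have eig' i : g i * mu A w i = rho * w i.
  by rewrite /mu eig; field; rewrite !gt_eqF.
by exists w => // i; rewrite (lambda_maxE Asym A_ge0 Aconn Anbip g w rho i0 g0 w0 eig').
Qed.

Lemma not_cvg0_ae : 1 < lambda_max (J0 A gamma) -> {ae P, forall z,
  ~ forall i, (fun k => betaS b1 (decl psi z) k i) @ \oo --> (0 : R)}.
Proof.
move=> lam1; have [i0 _] := gamma_neq1; have [w w0 eig] := perron_J0 gamma gamma_gt0.
have := repelled_ae Asym A_ge0 Aconn Anbip gamma b1 gamma_gt0 b1_itv psi psi_meas psi_law
  w (lambda_max (J0 A gamma)) w0 eig lam1.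
apply: filterS => z [c c0 [K _ hK]] cvg0.
have /cvgrPdist_lt/(_ c c0)[K' _ hK'] := cvg0 i0.
have := hK' (maxn K K') (leq_maxr _ _); have := hK (maxn K K') (leq_maxl _ _) i0.
by rewrite /= sub0r normrN ltr_norml => h1 /andP[_ h2]; lra.
Qed.

(** By [eig_inv_gt1] the corner [1] is repelling. Repulsion from [0] for the complemented process
    bounds [beta] away from [1], as [quiet_cvg0] requires. *)
Lemma cvg0_ae : lambda_max (J0 A gamma) <= 1 -> {ae P, forall z,
  forall i, (fun k => betaS b1 (decl psi z) k i) @ \oo --> (0 : R)}.
Proof.
move=> lam1; have [w w0 eig] := perron_J0 gamma gamma_gt0.
have gV0 i : 0 < (gamma i)^-1 by rewrite invr_gt0.
have [w' w'0 eig'] := perron_J0 (fun i => (gamma i)^-1) gV0.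
have lam'1 := eig_inv_gt1 Asym A_ge0 Aconn Anbip gamma w _ w' _ gamma_gt0 gamma_neq1
  w0 eig lam1 w'0 eig'.
have b1V i : 0 < 1 - b1 i < 1 by case/andP: (b1_itv i); lra.
have measV t i : measurable [set z | ~~ psi t i z].
  rewrite (_ : [set z | _] = ~` [set z | psi t i z]); first exact: measurableC.
  by apply/seteqP; split => z /= /negP.
have lawV := law_flip A_ge0 Aconn Anbip gamma b1 gamma_gt0 b1_itv P psi psi_law.
have rep := repelled_ae Asym A_ge0 Aconn Anbip _ _ gV0 b1V _ measV lawV w' _ w'0 eig' lam'1.
have qui := quiet_ae A_ge0 Aconn Anbip gamma b1 gamma_gt0 b1_itv psi psi_meas psi_law.
move: rep qui; apply: filterS2 => z [c c0 [K _ hK]] qz.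
apply: (quiet_cvg0 Asym A_ge0 Aconn Anbip gamma b1 gamma_gt0 b1_itv w _ _ gamma_neq1 w0 eig lam1 qz).
exists c => //; exists K => // k /= Kk i.
have := hK k Kk i; rewrite (betaS_flip b1 (decl psi z)); lra.
Qed.

End AtZero.

Theorem theorem3 (d : measure_display) (T : measurableType d) (R : realType)
  (P : probability T R) (n : nat) (A : 'M[R]_n) (gamma : 'I_n -> R)
  (b1 : 'I_n -> R) (psi : nat -> 'I_n -> T -> bool) (b : bool) :
  A^T = A ->
  (forall i j, 0 <= A i j) ->
  graph_connected A ->
  ~ graph_bipartite A ->
  (forall i, 0 < gamma i) ->
  (exists i, gamma i != 1) ->
  (forall i, 0 < b1 i < 1) ->
  (forall t i, measurable [set w | psi t i w]) ->
  (forall (m : nat) (h : nat -> 'I_n -> bool) (s : 'I_n -> bool),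
     P (hist_event psi m h `&` [set w | forall i, psi m.+2 i w = s i])
     = (P (hist_event psi m h)
        * (\prod_(i < n) bern (f (mu A (betaS b1 h m) i) (gamma i)) (s i))%:E)%E) ->
  let conv := [set w | forall i,
        (fun k => betaS b1 (fun t j => psi t j w) k i) @ \oo --> @xvec R n b i] in
  (1 < lambda_max (Jx b A gamma) -> P conv = 0%E) /\
  (lambda_max (Jx b A gamma) <= 1 -> P conv = 1%E).
Proof.
move=> Asym A_ge0 Aconn Anbip gamma_gt0 gamma_neq1 b1_itv psi_meas psi_law conv.
have mconv : measurable conv by exact: measurable_cvg psi_law _.
suff [unstable stable] : (1 < lambda_max (Jx b A gamma) -> {ae P, forall z, ~ conv z}) /\
    (lambda_max (Jx b A gamma) <= 1 -> {ae P, forall z, conv z}).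
  split=> [/unstable|/stable] ae_conv.
    apply/negligibleP => //; apply: negligibleS ae_conv => z cz; exact.
  have PC : P (~` conv) = 0%E by apply/negligibleP; [exact: measurableC|].
  by rewrite -[conv]setCK probability_setC ?PC ?sube0 //; exact: measurableC.
rewrite /conv /xvec /Jx; case: b {conv mconv} => /=; last first.
  split=> lam.
    exact: (not_cvg0_ae Asym A_ge0 Aconn Anbip _ _ gamma_gt0 gamma_neq1 b1_itv _ psi_meas psi_law).
  exact: (cvg0_ae Asym A_ge0 Aconn Anbip _ _ gamma_gt0 gamma_neq1 b1_itv _ psi_meas psi_law).
(* The corner [1] is the corner [0] of the complemented process. [J0 A] at the inverse biases is
   convertible to [J1 A gamma], so [lam] will fit as it stands. *)
have gV0 i : 0 < (gamma i)^-1 by rewrite invr_gt0.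
have gV1 : exists i, (gamma i)^-1 != 1 by have [i gi] := gamma_neq1; exists i; rewrite invr_eq1.
have b1V i : 0 < 1 - b1 i < 1 by case/andP: (b1_itv i); lra.
have measV t i : measurable [set z | ~~ psi t i z].
  rewrite (_ : [set z | _] = ~` [set z | psi t i z]); first exact: measurableC.
  by apply/seteqP; split => z /= /negP.
have lawV := law_flip A_ge0 Aconn Anbip gamma b1 gamma_gt0 b1_itv P psi psi_law.
have cvg1E z : (forall i, betaS b1 (fun t j => psi t j z) k i @[k --> \oo] --> (1 : R)) <->
    (forall i, betaS (fun j => 1 - b1 j) (decl (fun t j z => ~~ psi t j z) z) k i
      @[k --> \oo] --> (0 : R)).
  have E i k : betaS (fun j => 1 - b1 j) (decl (fun t j z => ~~ psi t j z) z) k i =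
      1 - betaS b1 (fun t j => psi t j z) k i.
    exact: (congr1 (@^~ i) (betaS_flip b1 (fun t j => psi t j z) k)).
  split=> cz i; apply/cvgrPdist_lt => e e0.
    have /cvgrPdist_lt/(_ e e0) := cz i; apply: filterS => k.
    by rewrite E sub0r normrN.
  have /cvgrPdist_lt/(_ e e0) := cz i; apply: filterS => k.
  by rewrite E sub0r normrN.
split=> lam.
  have := not_cvg0_ae Asym A_ge0 Aconn Anbip _ _ gV0 gV1 b1V _ measV lawV lam.
  by apply: filterS => z nz /cvg1E.
have := cvg0_ae Asym A_ge0 Aconn Anbip _ _ gV0 gV1 b1V _ measV lawV lam.
by apply: filterS => z /cvg1E.
Qed.
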